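(* (i) For any prime power $q\equiv 3 \pmod 4$, there exists a $(\mathbb Z_{(q-1)/2},(q-3)/4,(q-7)/4)$-DF. (ii) For any prime power $q=1+4t^2$ with $t$ an odd integer, there exists a $(\mathbb Z_{(q-1)/4},(q-5)/16,(q-21)/16)$-DF. (iii) For any prime power $q=9+64a^2=1+8b^2$ with $a$ and $b$ odd integers, there exists a $(\mathbb Z_{(q-1)/8},(q-9)/64,(q-73)/64)$-DF.
   Context: $\mathbb Z_s=\mathbb Z/s\mathbb Z$ (additive group). Let $G$ be a finite abelian group, written additively. For an indexed family $\mathcal F=\{D_i\mid 1\le i\le b\}$ of subsets (''blocks'') of $G$ and $d\in G$, put $\theta_{\mathcal F}(d)=\sum_{i=1}^b|\{(x,y)\mid x,y\in D_i,\ x\neq y,\ x-y=d\}|$. The family $\mathcal F$ is a $(G,k,\lambda)$ difference family ($(G,k,\lambda)$-DF) if every block has size $k$ and $\theta_{\mathcal F}(d)=\lambda$ for all $d\in G\setminus\{0\}$. *)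

(* Defs.v *)
From HB Require Import structures.
From mathcomp Require Import all_boot all_order all_algebra.

Set Implicit Arguments.
Unset Strict Implicit.
Unset Printing Implicit Defensive.

Import GRing.Theory.

Local Open Scope ring_scope.

Definition prime_power (q : nat) : Prop :=
  exists p e : nat, [/\ prime p, (0 < e)%N & q = (p ^ e)%N].

(* For s > 0 this is the set {0, ..., s-1} with addition mod s.  The notation
   'Z_s is not suitable: 'Z_1 is Z/2Z, whereas s = 1 has to be the trivial
   group. *)
Definition Zmod (s : nat) : finZmodType := 'I_(s.-1.+1).

Section DifferenceFamily.

Variable G : finZmodType.

Definition theta (b : nat) (D : 'I_b -> {set G}) (d : G) : nat :=
  (\sum_(i < b) #|[set p : G * G |
     [&& p.1 \in D i, p.2 \in D i, p.1 != p.2 & (p.1 - p.2 == d)%R]]|)%N.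

(* lambda is an integer because formulas for it may be negative when G is
   trivial, in which case the condition on theta is vacuous. *)
Definition is_DF (k : nat) (lambda : int) (b : nat) (D : 'I_b -> {set G}) :
    Prop :=
  (forall i : 'I_b, #|D i| = k) /\
  (forall d : G, d != 0 -> (theta D d)%:Z = lambda).

(* A family is indexed by 1 <= i <= b with b >= 1: without 0 < b, the empty
   family would be a (G, k, 0)-DF for every k. *)
Definition DF_exists (k : nat) (lambda : int) : Prop :=
  exists (b : nat) (D : 'I_b -> {set G}), (0 < b)%N /\ is_DF k lambda D.

End DifferenceFamily.

(* Main.v *)
Require Import Defs.
From HB Require Import structures.
From mathcomp Require Import all_boot all_order all_algebra.
From mathcomp Require Import all_fingroup all_solvable all_field all_character.
From mathcomp Require Import ring zify.

Set Implicit Arguments.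
Unset Strict Implicit.
Unset Printing Implicit Defensive.

Import Order.TTheory GRing.Theory Num.Theory.

Local Open Scope ring_scope.

(** Let q = e f + 1 be a prime power, and let C be the subgroup of order f of
the multiplicative group of the field F of q elements, that is, the group of
nonzero e-th powers.  Suppose that C is a difference set in the additive group
of F: every d <> 0 has the same number N of representations d = x - y with x
and y in C.  Then the e sets of those c in C for which c - g^i is again in C,
where i < e and g is a primitive root, all have N elements.  Read through
discrete logarithms they are blocks in Z/f.  A multiplicative difference r <> 1
occurs in them once for each u <> 0 with 1 - u and r - u both in C, because the
quotients g^i / c with i < e and c in C run through all nonzero elements of F.
All u together give N such solutions, and u = 0 is one of them, so the blocks
form a difference family with lambda = N - 1 ([DF_of_difference_set]).

It remains to see that C is a difference set for e = 2, 4, 8.  Expanding the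
indicator function of C in the characters of order dividing e gives
  e^2 N(d) = sum over i, j < e of chi(d)^(i+j) chi(-1)^j J(chi^i, chi^j)
([shift_countE]), where f is odd, so that chi(-1) = -1.  The terms with i + j
odd cancel in pairs.  For e = 2 nothing depends on d any more.

For e = 4 the formula involves only the real part a of J(chi, chi) = a + b i
([shift_count4]), and for e = 8, after the classical relations among Jacobi
sums, only J(chi^2, chi^4) = a + b i, the real part c of
J(chi, chi^4) = c + d sqrt(-2), and the sign u = chi(4) ([shift_count8]).
Jacobi sums have norm q, so q = a^2 + b^2 and q = c^2 + 2 d^2.  The hypotheses
supply another representation of q by the same forms, and representations of a
prime power that are prime to p are unique up to signs and order
([norm_form_unique]).  That p does not divide a or c is seen by replacing the
complex values of the characters by their values in F itself: a Jacobi sum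
then becomes a sum of x^(i f) (1 - x)^(j f) over F, which is 0 or a binomial
coefficient up to sign ([Jacobi_pow]), and this coefficient is prime to p
([prime_Ndvd_bin]).

Finitely many values of a, c and u are left.  Since N(1) and N(g) are
integers, congruences modulo powers of 2 leave just one of them: a = -1 for
e = 4, and a = 3, c = -1, u = 1 for e = 8.  For these values all terms that
depend on d vanish. *)

(** * Multiplicative characters and Jacobi sums *)

Lemma finField_prim_root (F : finFieldType) :
  exists g : F, #|F|.-1.-primitive_root g.
Proof.
have n_gt0 : (0 < #|F|.-1)%N by have := finNzRing_gt1 F; case: #|F| => [|[]].
have /hasP[g _ gP] : has #|F|.-1.-primitive_root (enum [set~ (0 : F)]).
  apply: has_prim_root => //; last first.
  - by rewrite -cardE cardsC1.
  - exact: enum_uniq.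
  apply/allP => x; rewrite mem_enum !inE => x0.
  rewrite unity_rootE; apply/eqP; apply: (mulIf x0).
  rewrite mul1r -exprSr prednK ?expf_card //; exact: ltnW (finNzRing_gt1 F).
by exists g.
Qed.

Section Characters.

Variables (F : finFieldType) (g : F).
Local Notation n := #|F|.-1.
Hypothesis g_prim : n.-primitive_root g.

Let q_gt1 : (1 < #|F|)%N. Proof. exact: finNzRing_gt1. Qed.
Let n_gt0 : (0 < n)%N. Proof. by have := q_gt1; case: #|F| => [|[]]. Qed.

Lemma prim_root_neq0 : g != 0.
Proof.
apply/eqP => g0; have := prim_expr_order g_prim.
by rewrite g0 expr0n gtn_eqF // => /esym/eqP; rewrite oner_eq0.
Qed.

Lemma expf_pred_card (x : F) : x != 0 -> x ^+ n = 1.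
Proof.
move=> x0; apply: (mulIf x0).
by rewrite mul1r -exprSr prednK ?expf_card // ltnW.
Qed.

Definition dlog (x : F) : nat := index x [seq g ^+ i | i <- iota 0 n].

Lemma dlogK (x : F) : x != 0 -> g ^+ dlog x = x.
Proof.
move=> x0.
have xin : x \in [seq g ^+ i | i <- iota 0 n].
  have [i ->] := prim_rootP g_prim (expf_pred_card x0).
  by apply/mapP; exists (i : nat) => //; rewrite mem_iota add0n leq0n ltn_ord.
have := nth_index 0 xin; rewrite -/(dlog x) (nth_map 0%N) ?nth_iota //.
all: by move: xin; rewrite -index_mem size_map size_iota.
Qed.

Section Values.

Variable R : fieldType.
Implicit Types (z w : R) (x y : F).

(** The multiplicative character that sends [g] to [z], for [z] a root of unity
of order dividing [n]; multiplying characters is multiplying the parameters.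
The trivial character also vanishes at 0.  The values may lie in any field,
and both the complex numbers and [F] itself are used below. *)
Definition chi (z : R) (x : F) : R := if x == 0 then 0 else z ^+ dlog x.

Lemma chi0 z : chi z 0 = 0. Proof. by rewrite /chi eqxx. Qed.

Lemma chiX z i : z ^+ n = 1 -> chi z (g ^+ i) = z ^+ i.
Proof.
move=> zn; have gi0 : g ^+ i != 0 by rewrite expf_neq0 // prim_root_neq0.
rewrite /chi (negbTE gi0).
have /eqP := dlogK gi0; rewrite (eq_prim_root_expr g_prim) => /eqP Em.
by rewrite -(expr_mod _ zn) Em expr_mod.
Qed.

Lemma chi1 z : z ^+ n = 1 -> chi z 1 = 1.
Proof. by move=> zn; rewrite -(expr0 g) chiX // expr0. Qed.

Lemma chiM z x y : z ^+ n = 1 -> chi z (x * y) = chi z x * chi z y.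
Proof.
move=> zn; have [->|x0] := eqVneq x 0; first by rewrite mul0r chi0 mul0r.
have [->|y0] := eqVneq y 0; first by rewrite mulr0 chi0 mulr0.
by rewrite -(dlogK x0) -(dlogK y0) -exprD !chiX // exprD.
Qed.

Lemma chi_mul z w x : chi (z * w) x = chi z x * chi w x.
Proof. by rewrite /chi; case: eqP => _; rewrite ?mulr0 ?exprMn. Qed.

Lemma chi_one x : chi 1 x = (x != 0)%:R.
Proof. by rewrite /chi; case: eqP => _ //=; rewrite expr1n. Qed.

Lemma chi_inv z x : chi z^-1 x = (chi z x)^-1.
Proof. by rewrite /chi; case: eqP => _; rewrite ?invr0 ?exprVn. Qed.

Lemma chi_neq0 z x : z != 0 -> x != 0 -> chi z x != 0.
Proof. by move=> z0 x0; rewrite /chi (negbTE x0) expf_neq0. Qed.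

Lemma chi_exp_arg z x i : z ^+ n = 1 -> chi z (x ^+ i.+1) = chi z x ^+ i.+1.
Proof. by move=> zn; elim: i => // i IH; rewrite exprS chiM // IH -exprS. Qed.

Lemma chiV z x : z ^+ n = 1 -> chi z x^-1 = (chi z x)^-1.
Proof.
move=> zn; have [->|x0] := eqVneq x 0; first by rewrite invr0 chi0 invr0.
have cx : chi z x * chi z x^-1 = 1 by rewrite -chiM // divff // chi1.
have cx0 : chi z x != 0.
  by apply/eqP => c0; move: cx; rewrite c0 mul0r => /esym/eqP; rewrite oner_eq0.
by apply: (mulfI cx0); rewrite cx divff.
Qed.

Lemma sum_chi z : z ^+ n = 1 -> z != 1 -> \sum_x chi z x = 0.
Proof.
move=> zn z1; have g0 := prim_root_neq0.
have E : \sum_x chi z x = z * \sum_x chi z x.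
  rewrite mulr_sumr [LHS](reindex_inj (mulfI g0)) /=.
  by apply: eq_bigr => x _; rewrite chiM // -[g in chi z g]expr1 chiX // expr1.
apply/eqP; have /eqP : (1 - z) * \sum_x chi z x = 0.
  by rewrite mulrBl mul1r -E subrr.
by rewrite mulf_eq0 subr_eq0 eq_sym (negbTE z1).
Qed.

Lemma sum_indicator_neq0 : \sum_(x : F) (x != 0)%:R = #|F|%:R - 1 :> R.
Proof.
rewrite (bigD1 0) //= eqxx add0r.
rewrite (eq_bigr (fun _ => 1)); last by move=> x ->.
rewrite sumr_const cardC1 -subn1 natrB // ltnW //.
Qed.

Definition Jacobi z w : R := \sum_x chi z x * chi w (1 - x).

Lemma reflect_inj : injective (fun x : F => 1 - x).
Proof. by move=> x y /addrI /oppr_inj. Qed.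

Lemma JacobiC z w : Jacobi z w = Jacobi w z.
Proof.
rewrite /Jacobi (reindex_inj reflect_inj) /=; apply: eq_bigr => x _.
by rewrite mulrC opprB addrC subrK.
Qed.

Lemma Jacobi11 : Jacobi 1 1 = #|F|%:R - 2.
Proof.
rewrite /Jacobi (bigD1 1) //= subrr chi0 mulr0 add0r.
transitivity (\sum_(x : F | x != 1) (x != 0)%:R : R).
  apply: eq_bigr => x x1; rewrite !chi_one [1 - x == 0]subr_eq0 [1 == x]eq_sym x1.
  by rewrite mulr1.
have := sum_indicator_neq0; rewrite (bigD1 1) //= oner_neq0 => /(canRL (addKr _)) ->.
by rewrite mulr1n; ring.
Qed.

Lemma Jacobi1 w : w ^+ n = 1 -> w != 1 -> Jacobi 1 w = -1.
Proof.
move=> wn w1; have := sum_chi wn w1; rewrite (reindex_inj reflect_inj) /=.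
rewrite (bigD1 0) //= subr0 chi1 // => /(canRL (addKr _)); rewrite addr0 => <-.
rewrite /Jacobi (bigD1 0) //= chi0 mul0r add0r.
by apply: eq_bigr => x x0; rewrite chi_one x0 mul1r.
Qed.

Lemma uroot_neq0 z : z ^+ n = 1 -> z != 0.
Proof.
move=> zn; apply/eqP => z0; move: zn; rewrite z0 expr0n gtn_eqF // => /esym/eqP.
by rewrite oner_eq0.
Qed.

Lemma urootM z w : z ^+ n = 1 -> w ^+ n = 1 -> (z * w) ^+ n = 1.
Proof. by move=> zn wn; rewrite exprMn zn wn mulr1. Qed.

Lemma urootV z : z ^+ n = 1 -> z^-1 ^+ n = 1.
Proof. by move=> zn; rewrite exprVn zn invr1. Qed.

Lemma urootX z i : z ^+ n = 1 -> (z ^+ i) ^+ n = 1.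
Proof. by move=> zn; rewrite exprAC zn expr1n. Qed.

Lemma chiN1_sqr z : z ^+ n = 1 -> chi z (-1) ^+ 2 = 1.
Proof. by move=> zn; rewrite expr2 -chiM // mulrNN mulr1 chi1. Qed.

(** The involution x |-> x / (x - 1) turns 1 - x into (1 - x)^-1, so it moves
the exponents of both characters onto one factor. *)
Lemma Jacobi_reflect z w : z ^+ n = 1 -> w ^+ n = 1 ->
  Jacobi z w = chi z (-1) * Jacobi z (z * w)^-1.
Proof.
move=> zn wn; pose s (x : F) := x / (x - 1).
have sK (x : F) : x != 1 -> s x != 1.
  move=> x1; have x10 : x - 1 != 0 by rewrite subr_eq0.
  apply/eqP => /(congr1 (fun t => t * (x - 1))); rewrite /s mulfVK // mul1r.
  by move/eqP; rewrite -subr_eq0 opprB addrC subrK oner_eq0.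
have ss (x : F) : x != 1 -> s (s x) = x.
  move=> x1; have x10 : x - 1 != 0 by rewrite subr_eq0.
  rewrite /s; have -> : x / (x - 1) - 1 = (x - 1)^-1 by field.
  by rewrite invrK mulfVK.
rewrite /Jacobi mulr_sumr (bigD1 1) //= subrr chi0 mulr0 add0r.
rewrite [RHS](bigD1 1) //= subrr chi0 !mulr0 add0r.
rewrite (reindex_onto s s) /=; last by move=> x; exact: ss.
apply: eq_big => [x|x /andP[sx1 /eqP sE]].
  apply/andP/idP => [[sx /eqP E]|x1]; last by rewrite sK // ss.
  apply/eqP => x1; move: E; rewrite x1 /s subrr invr0 mulr0 sub0r mul0r.
  by move/esym/eqP; rewrite oner_eq0.
have x1 : x != 1.
  apply/eqP => x1; move: sE; rewrite x1 /s subrr invr0 mulr0 sub0r mul0r.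
  by move/esym/eqP; rewrite oner_eq0.
have x10 : x - 1 != 0 by rewrite subr_eq0.
have x10' : 1 - x != 0 by rewrite subr_eq0 eq_sym.
have -> : 1 - s x = (1 - x)^-1 by rewrite /s; field; rewrite ?x10 ?x10'.
have -> : s x = -1 * x * (1 - x)^-1 by rewrite /s; field; rewrite ?x10 ?x10'.
rewrite !chiM // !chiV // !chi_inv // chi_mul invfM.
by rewrite -!mulrA.
Qed.

Lemma Jacobi_inv z : z ^+ n = 1 -> z != 1 -> Jacobi z z^-1 = - chi z (-1).
Proof.
move=> zn z1; rewrite Jacobi_reflect ?urootV // divff ?uroot_neq0 // invr1 JacobiC.
by rewrite Jacobi1 // mulrN1.
Qed.

End Values.
End Characters.

(** * Gauss sums and the norm of a Jacobi sum *)

(** Any nonprincipal irreducible character of the additive group, which is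
linear because the group is abelian. *)
Lemma additive_character (F : finFieldType) :
  exists psi : F -> algC,
    [/\ psi 0 = 1, forall x y, psi (x + y) = psi x * psi y & \sum_x psi x = 0].
Proof.
pose G := [set: F]%G.
have abG : abelian G by apply/centsP => x _ y _; exact: (addrC (x : F) y).
have [i i0] : exists i : Iirr G, i != 0.
  have /card_gt0P[i] : (0 < #|predC1 (0%R : Iirr G)|)%N.
    by rewrite cardC1 card_Iirr_abelian // cardsT -subn1 subn_gt0 finNzRing_gt1.
  by rewrite inE => i0; exists i.
have lin : 'chi_i \is a linear_char by exact: (char_abelianP _ abG).
exists (fun x => 'chi_i x); split=> [|x y|].
- exact: (lin_char1 lin).
- exact: (lin_charM lin (in_setT x) (in_setT y)).
have := cfdot_irr i 0; rewrite (negbTE i0) irr0 cfdotE => /eqP.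
rewrite mulf_eq0 invr_eq0 (negbTE (neq0CG _)) /= => /eqP S0.
rewrite -[RHS]S0; apply: eq_big => [x|x _]; first by rewrite inE.
by rewrite cfun1E inE rmorph1 mulr1.
Qed.

Section Gauss.

Variables (F : finFieldType) (g : F).
Local Notation n := #|F|.-1.
Hypothesis g_prim : n.-primitive_root g.
Variables (R : fieldType) (psi : F -> R).
Hypothesis psi0 : psi 0 = 1.
Hypothesis psiD : forall x y, psi (x + y) = psi x * psi y.
Hypothesis sum_psi : \sum_x psi x = 0.
Hypothesis q_neq0 : #|F|%:R != 0 :> R.
Implicit Types z w : R.

Local Notation chi := (@chi F g R).
Local Notation J := (@Jacobi F g R).

Definition Gauss z : R := \sum_x chi z x * psi x.

(** Grouping the double sum by s = x + y, the terms with s <> 0 are all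
multiples of the Jacobi sum; s = 0 contributes a complete character sum. *)
Lemma GaussM z w : z ^+ n = 1 -> w ^+ n = 1 ->
  Gauss z * Gauss w =
    chi w (-1) * (\sum_x chi (z * w) x)
    + J z w * (\sum_(s | s != 0) chi (z * w) s * psi s).
Proof.
move=> zn wn; have zwn := urootM zn wn.
rewrite /Gauss mulr_suml.
have -> : \sum_x chi z x * psi x * (\sum_y chi w y * psi y) =
          \sum_s psi s * \sum_x chi z x * chi w (s - x).
  transitivity (\sum_x \sum_s psi s * (chi z x * chi w (s - x))).
    apply: eq_bigr => x _; rewrite mulr_sumr.
    rewrite [RHS](reindex_inj (addrI x)) /=; apply: eq_bigr => y _.
    by have -> : x + y - x = y by [ring]; rewrite psiD; ring.
  by rewrite exchange_big; apply: eq_bigr => s _; rewrite mulr_sumr.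
rewrite (bigD1 0) //= psi0 mul1r; congr (_ + _).
  rewrite mulr_sumr; apply: eq_bigr => x _.
  by rewrite sub0r -[- x]mulN1r chiM // chi_mul; ring.
rewrite mulr_sumr; apply: eq_bigr => s s0; rewrite mulrC mulrA; congr (_ * _).
rewrite /Jacobi (reindex_inj (mulfI s0)) /= !mulr_suml; apply: eq_bigr => x _.
have -> : s - s * x = s * (1 - x) by ring.
by rewrite !chiM // chi_mul; ring.
Qed.

Lemma Gauss_Jacobi z w : z ^+ n = 1 -> w ^+ n = 1 -> z * w != 1 ->
  Gauss z * Gauss w = J z w * Gauss (z * w).
Proof.
move=> zn wn zw1; rewrite GaussM // sum_chi // ?urootM // mulr0 add0r.
by congr (_ * _); rewrite /Gauss [RHS](bigD1 0) //= chi0 mul0r add0r.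
Qed.

Lemma Gauss_inv z : z ^+ n = 1 -> z != 1 ->
  Gauss z * Gauss z^-1 = chi z (-1) * #|F|%:R.
Proof.
move=> zn z1; have z0 : z != 0 by exact: uroot_neq0 zn.
rewrite GaussM ?urootV // divff // Jacobi_inv //.
rewrite (eq_bigr (fun x => (x != 0)%:R)); last by move=> x _; rewrite chi_one.
rewrite sum_indicator_neq0.
have -> : \sum_(s | s != 0) chi 1 s * psi s = -1.
  have := sum_psi; rewrite (bigD1 0) //= => /(canRL (addKr _)).
  rewrite psi0 addr0 => <-; apply: eq_bigr => s s0.
  by rewrite chi_one s0 mul1r.
have -> : chi z^-1 (-1) = chi z (-1).
  rewrite chi_inv; apply: (mulfI (x := chi z (-1))).
    by rewrite chi_neq0 // oppr_eq0 oner_eq0.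
  by rewrite divff ?chi_neq0 // ?oppr_eq0 ?oner_eq0 // -expr2 chiN1_sqr.
by ring.
Qed.

Lemma Gauss_neq0 z : z ^+ n = 1 -> z != 1 -> Gauss z != 0.
Proof.
move=> zn z1; have := Gauss_inv zn z1.
have : chi z (-1) * #|F|%:R != 0.
  by rewrite mulf_neq0 // chi_neq0 ?(uroot_neq0 zn) // oppr_eq0 oner_eq0.
by move=> h E; apply: contraNneq h => G0; rewrite -E G0 mul0r.
Qed.

(** A Jacobi sum is a quotient of Gauss sums, and the Gauss sums of opposite
characters multiply to q up to sign; the signs cancel. *)
Lemma Jacobi_mul_inv_add_char z w : z ^+ n = 1 -> w ^+ n = 1 ->
  z != 1 -> w != 1 -> z * w != 1 -> J z w * J z^-1 w^-1 = #|F|%:R.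
Proof.
move=> zn wn z1 w1 zw1; have zwn := urootM zn wn.
have [z0 w0] : z != 0 /\ w != 0 by split; apply: uroot_neq0; eassumption.
have zw1' : z^-1 * w^-1 != 1 by rewrite -invfM invr_eq1.
have E1 := Gauss_Jacobi zn wn zw1.
have E2 := Gauss_Jacobi (urootV zn) (urootV wn) zw1'; rewrite -invfM in E2.
have E3 := Gauss_inv zwn zw1; have E4 := Gauss_inv zn z1; have E5 := Gauss_inv wn w1.
have N10 : -1 != 0 :> F by rewrite oppr_eq0 oner_eq0.
have c0 : chi (z * w) (-1) * #|F|%:R != 0 by rewrite mulf_neq0 // chi_neq0 // mulf_neq0.
apply: (mulfI c0); rewrite -[in LHS]E3.
transitivity ((Gauss z * Gauss w) * (Gauss z^-1 * Gauss w^-1)).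
  by rewrite E1 E2; ring.
transitivity ((Gauss z * Gauss z^-1) * (Gauss w * Gauss w^-1)); first by ring.
by rewrite E4 E5 chi_mul; ring.
Qed.

(** Both sides times the Gauss sum of [z * w * t] are the product of the three
Gauss sums. *)
Lemma Jacobi_cocycle_add_char z w t : z ^+ n = 1 -> w ^+ n = 1 -> t ^+ n = 1 ->
  z * w != 1 -> w * t != 1 -> z * w * t != 1 ->
  J z w * J (z * w) t = J z (w * t) * J w t.
Proof.
move=> zn wn tn zw wt zwt; have G0 := Gauss_neq0 (urootM (urootM zn wn) tn) zwt.
apply: (mulIf G0).
have zwn := urootM zn wn; have wtn := urootM wn tn.
have E1 := Gauss_Jacobi zn wn zw; have E2 := Gauss_Jacobi zwn tn zwt.
have E3 := Gauss_Jacobi wn tn wt.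
have E4 : Gauss z * Gauss (w * t) = J z (w * t) * Gauss (z * w * t).
  by rewrite -mulrA in zwt *; exact: Gauss_Jacobi.
transitivity (J z w * (J (z * w) t * Gauss (z * w * t))); first by ring.
rewrite -E2 mulrA -E1 -mulrA E3.
transitivity (Gauss z * Gauss (w * t) * J w t); first by ring.
by rewrite E4; ring.
Qed.

End Gauss.

Section JacobiComplex.

Variables (F : finFieldType) (g : F).
Local Notation n := #|F|.-1.
Hypothesis g_prim : n.-primitive_root g.
Implicit Types z w : algC.
Local Notation chi := (@chi F g algC).
Local Notation J := (@Jacobi F g algC).

Let q_neq0 : #|F|%:R != 0 :> algC.
Proof. by rewrite pnatr_eq0 -lt0n; exact: ltnW (finNzRing_gt1 F). Qed.

(** The second factor is the complex conjugate of the first: this is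
|J|^2 = q. *)
Lemma Jacobi_mul_inv z w : z ^+ n = 1 -> w ^+ n = 1 ->
  z != 1 -> w != 1 -> z * w != 1 -> J z w * J z^-1 w^-1 = #|F|%:R.
Proof.
by have [psi [p0 pD p_sum]] := additive_character F; exact: (Jacobi_mul_inv_add_char g_prim p0 pD p_sum).
Qed.

Lemma Jacobi_cocycle z w t : z ^+ n = 1 -> w ^+ n = 1 -> t ^+ n = 1 ->
  z * w != 1 -> w * t != 1 -> z * w * t != 1 ->
  J z w * J (z * w) t = J z (w * t) * J w t.
Proof.
by have [psi [p0 pD p_sum]] := additive_character F; exact: (Jacobi_cocycle_add_char g_prim p0 pD p_sum).
Qed.

End JacobiComplex.

(** * Jacobi sums and the quadratic character *)

Section Doubling.

Variables (F : finFieldType) (g : F).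
Local Notation n := #|F|.-1.
Hypothesis g_prim : n.-primitive_root g.
Hypothesis n_even : ~~ odd n.

Lemma expN1_pred_card (R : nzRingType) : (-1) ^+ n = 1 :> R.
Proof. by rewrite -signr_odd (negbTE n_even). Qed.

Lemma even_prim_half : g ^+ n./2 = -1.
Proof.
have n_gt0 : (0 < n)%N by have := finNzRing_gt1 F; case: #|F| => [|[]].
have h2 : (n./2).*2 = n by rewrite even_halfK.
have : (g ^+ n./2) ^+ 2 = 1.
  by rewrite -exprM muln2 h2 prim_expr_order.
move/eqP; rewrite sqrf_eq1 => /orP[|/eqP//].
rewrite -(prim_order_dvd g_prim) => /dvdn_leq; lia.
Qed.

Lemma two_neq0 : 2%:R != 0 :> F.
Proof.
apply/eqP => E.
have n_gt0 : (0 < n)%N by have := finNzRing_gt1 F; case: #|F| => [|[]].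
have : g ^+ n./2 == g ^+ 0.
  rewrite even_prim_half expr0 -subr_eq0 -opprD oppr_eq0.
  by apply/eqP; rewrite -[RHS]E; ring.
rewrite (eq_prim_root_expr g_prim) mod0n => /dvdn_leq; lia.
Qed.

Variable R : fieldType.
Local Notation chi := (@chi F g R).
Local Notation J := (@Jacobi F g R).

(** [chi (-1)] is the quadratic character. *)
Lemma card_sqrt t : #|[set y : F | y ^+ 2 == t]|%:R = 1 + chi (-1) t :> R.
Proof.
have [->|t0] := eqVneq t 0.
  rewrite chi0 addr0; have -> : [set y : F | y ^+ 2 == 0] = [set 0].
    by apply/setP => y; rewrite !inE sqrf_eq0.
  by rewrite cards1.
rewrite -(dlogK g_prim t0) chiX ?expN1_pred_card //; move: (dlog g t) => i.
rewrite -signr_odd; have [io|ie] := boolP (odd i).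
  rewrite expr1 subrr; apply/eqP; suff -> : [set y | y ^+ 2 == g ^+ i] = set0 by rewrite cards0.
  apply/setP => y; rewrite !inE; apply/negbTE/eqP => E.
  have y0 : y != 0.
    apply/eqP => y0; have := expf_neq0 i (prim_root_neq0 g_prim).
    by rewrite -E y0 expr0n eqxx.
  move/eqP: E; rewrite -(dlogK g_prim y0) -exprM (eq_prim_root_expr g_prim).
  move=> /eqP /(congr1 odd).
  by rewrite !odd_mod ?(negbTE n_even) // oddM andbF io.
have -> : [set y : F | y ^+ 2 == g ^+ i] = [set g ^+ i./2; - g ^+ i./2].
  apply/setP => y; rewrite !inE -eqf_sqr -exprM muln2 even_halfK //.
suff E : g ^+ i./2 != - g ^+ i./2 by rewrite cards2 E expr0.
rewrite -subr_eq0 opprK -mulr2n -mulr_natl mulf_eq0.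
by rewrite (negbTE two_neq0) expf_eq0 (negbTE (prim_root_neq0 g_prim)) andbF.
Qed.

(** Since 4 x (1 - x) = 1 - (2 x - 1)^2, the left side is a sum over squares,
and a square t is taken 1 + chi (-1) t times. *)
Lemma Jacobi_double z : z ^+ n = 1 -> z != 1 ->
  chi z 4 * J z z = J z (-1).
Proof.
move=> zn z1; transitivity (\sum_y chi z (1 - y ^+ 2)).
  have inj : injective (fun x : F => 2%:R * x - 1).
    by move=> x y /addIr /(mulfI two_neq0).
  rewrite [RHS](reindex_inj inj) /= /Jacobi mulr_sumr; apply: eq_bigr => x _.
  by rewrite -!chiM //; congr (chi z _); ring.
transitivity (\sum_t chi z (1 - t) * (1 + chi (-1) t)).
  rewrite (partition_big (fun y : F => y ^+ 2) xpredT) //=; apply: eq_bigr => t _.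
  rewrite (eq_bigr (fun _ => chi z (1 - t))); last by move=> y /eqP->.
  by rewrite sumr_const -mulr_natr -card_sqrt cardsE.
rewrite (eq_bigr (fun t => chi z (1 - t) + chi (-1) t * chi z (1 - t))); last first.
  by move=> t _; ring.
rewrite big_split /= -/(Jacobi g (-1) z) JacobiC.
by rewrite -(reindex_inj (@reflect_inj F) (P := xpredT) (F := chi z)) sum_chi // add0r.
Qed.

End Doubling.

Lemma algC_N1_neq1 : -1 != 1 :> algC.
Proof. by rewrite -subr_eq0 -opprD oppr_eq0 -mulr2n pnatr_eq0. Qed.

Section DoublingComplex.

Variables (F : finFieldType) (g : F).
Local Notation n := #|F|.-1.
Hypothesis g_prim : n.-primitive_root g.
Hypothesis n_even : ~~ odd n.
Local Notation chi := (@chi F g algC).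
Local Notation J := (@Jacobi F g algC).

(** The duplication formula: [- z] stands for the product of the character with
the quadratic one.  Apply [Jacobi_cocycle] to [z], [z], [-1] and eliminate
[J z z] with [Jacobi_double]; this needs [J z (-1) != 0], which the norm
gives. *)
Lemma Jacobi_mulN1 z : z ^+ n = 1 -> z ^+ 4 != 1 ->
  chi z 4 * J z (- z) = J (z ^+ 2) (-1).
Proof.
move=> zn z4.
have z2 : z ^+ 2 != 1 by apply: contraNneq z4 => E; rewrite (exprM z 2 2) E expr1n.
have z2' : - z ^+ 2 != 1.
  by apply: contraNneq z4 => /eqP; rewrite eqr_oppLR => /eqP E; rewrite (exprM z 2 2) E sqrrN expr1n.
have z1 : z != 1 by apply: contraNneq z2 => ->; rewrite expr1n.
have z1' : - z != 1 by apply: contraNneq z2 => E; rewrite -sqrrN E expr1n.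
have N1n := expN1_pred_card n_even algC.
have N11 := algC_N1_neq1.
have Jn : J z (-1) != 0.
  have := @Jacobi_mul_inv F g g_prim z (-1) zn N1n z1 N11; rewrite mulrN1 => /(_ z1').
  move=> E; apply: contraTneq (ltnW (finNzRing_gt1 F)) => J0.
  by rewrite lt0n -(pnatr_eq0 algC) -E J0 mul0r eqxx.
apply: (mulIf Jn); have := @Jacobi_cocycle F g g_prim z z (-1) zn zn N1n.
rewrite mulrN1 -expr2 mulrN1 => /(_ z2 z1' z2') E.
by rewrite -mulrA -E mulrA Jacobi_double // mulrC.
Qed.

End DoublingComplex.

(** * Jacobi sums with values in the field itself *)

Section Coefficients.

Variables (F : finFieldType) (g : F).
Local Notation n := #|F|.-1.
Hypothesis g_prim : n.-primitive_root g.

(** Coefficients of a Jacobi sum as a polynomial in the root of unity.  They do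
not depend on the field of values, which lets information obtained in
characteristic p bear on complex Jacobi sums. *)
Definition Jacobi_coef (e i j k : nat) : nat :=
  #|[set x : F | [&& x != 0%R, x != 1%R & (i * dlog g x + j * dlog g (1 - x)%R) %% e == k]]|%N.

Lemma Jacobi_coefE (R : fieldType) (z : R) e i j : (0 < e)%N -> z ^+ e = 1 ->
  Jacobi g (z ^+ i) (z ^+ j) =
    \sum_(0 <= k < e) (Jacobi_coef e i j k)%:R * z ^+ k.
Proof.
move=> e0 ze; rewrite big_mkord.
transitivity (\sum_(x : F | (x != 0) && (x != 1))
    z ^+ ((i * dlog g x + j * dlog g (1 - x)%R) %% e)%N).
  rewrite [RHS]big_mkcond; apply: eq_bigr => x _.
  have [->|x0] := eqVneq x 0; first by rewrite chi0 mul0r.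
  have [->|x1] := eqVneq x 1; first by rewrite subrr chi0 mulr0.
  rewrite /chi (negbTE x0) subr_eq0 eq_sym (negbTE x1) /= expr_mod //.
  by rewrite exprD !exprM.
rewrite (partition_big (fun x => Ordinal (ltn_pmod (i * dlog g x + j * dlog g (1 - x)%R)%N e0))
   xpredT) //=; apply: eq_bigr => k _.
rewrite (eq_bigr (fun _ => z ^+ k)); last by move=> x /andP[_ /eqP <-].
rewrite sumr_const mulr_natl /Jacobi_coef; congr (_ *+ _); apply: eq_card => x.
by rewrite inE -topredE /= -andbA.
Qed.

End Coefficients.

Section ResidueField.

Variables (F : finFieldType) (g : F).
Local Notation n := #|F|.-1.
Hypothesis g_prim : n.-primitive_root g.

Let n_gt0 : (0 < n)%N.
Proof. by have := finNzRing_gt1 F; case: #|F| => [|[]]. Qed.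

Lemma chi_pow a x : (0 < a)%N -> chi g (g ^+ a) x = x ^+ a.
Proof.
move=> a0; have [->|x0] := eqVneq x 0; first by rewrite chi0 expr0n gtn_eqF.
by rewrite /chi (negbTE x0) exprAC dlogK.
Qed.

Variable p : nat.
Hypothesis pF : p \in [pchar F].
Variable m : nat.
Hypotheses (m_gt0 : (0 < m)%N) (cardF : #|F| = (p ^ m)%N).

Lemma card_finField_eq0 : #|F|%:R = 0 :> F.
Proof. by rewrite cardF natrX (pcharf0 pF) expr0n gtn_eqF. Qed.

(** [x ^+ a] is the character of parameter [g ^+ a], and the total q - 1 of the
trivial character is -1 in [F]. *)
Lemma sum_pow a : (0 < a < n.*2)%N -> \sum_(x : F) x ^+ a = - (a == n)%:R.
Proof.
move=> /andP[a0 a2].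
transitivity (\sum_x chi g (g ^+ a) x); first by apply: eq_bigr => x _; rewrite chi_pow.
have [->|an] := eqVneq a n.
  rewrite prim_expr_order // (eq_bigr (fun x => (x != 0)%:R)); last by move=> x _; rewrite chi_one.
  by rewrite sum_indicator_neq0 card_finField_eq0 sub0r.
rewrite oppr0; apply: sum_chi => //; first by rewrite exprAC (prim_expr_order g_prim) expr1n.
rewrite -(prim_order_dvd g_prim); apply/negP => /dvdnP[k ak].
by move: a0 a2 an; rewrite ak; case: k {ak} => [|[|k]]; rewrite ?mul0n ?mul1n ?eqxx // -mul2n ltn_pmul2r.
Qed.

(** Expand (1 - x)^b: only the monomial of degree [n] survives the summation
over [F]. *)
Lemma Jacobi_pow a b : (0 < a)%N -> (0 < b)%N -> (a < n)%N -> (b < n)%N ->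
  Jacobi g (g ^+ a) (g ^+ b) =
    if (n <= a + b)%N then - (-1) ^+ (n - a) * 'C(b, n - a)%:R else 0.
Proof.
move=> a0 b0 an bn.
transitivity (\sum_(k < b.+1) (-1) ^+ k * 'C(b, k)%:R * \sum_(x : F) x ^+ (a + k)).
  rewrite /Jacobi; under eq_bigr => x _ do rewrite !chi_pow // exprBn mulr_sumr.
  rewrite exchange_big /=; apply: eq_bigr => k _; rewrite mulr_sumr.
  apply: eq_bigr => x _; rewrite expr1n exprD -mulr_natr; ring.
have E (k : 'I_b.+1) : \sum_(x : F) x ^+ (a + k) = - ((a + k)%N == n)%:R.
  by apply: sum_pow; rewrite -addnn; have := ltn_ord k; lia.
under eq_bigr => k _ do rewrite E.
case: leqP => [nab|nab].
  have kb : (n - a < b.+1)%N by lia.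
  rewrite (bigD1 (Ordinal kb)) //= subnKC ?eqxx; last exact: ltnW.
  rewrite big1 ?addr0; first by rewrite mulr1n mulrN1 mulNr.
  move=> k /eqP kE; case: eqP => [akn|]; last by rewrite oppr0 mulr0.
  by case: kE; apply: val_inj => /=; rewrite -akn addKn.
rewrite big1 // => k _; case: eqP => [akn|]; last by rewrite oppr0 mulr0.
by have := ltn_ord k; lia.
Qed.

End ResidueField.

(** * From a difference set of e-th powers to a difference family *)

Definition uroots (F : finFieldType) (f : nat) : {set F} := [set x | x ^+ f == 1].

Definition shift_count (F : finFieldType) (f : nat) (d : F) : nat :=
  #|[set x in uroots F f | x - d \in uroots F f]|.

Section DifferenceSet.

Variables (F : finFieldType) (g : F).
Local Notation n := #|F|.-1.
Hypothesis g_prim : n.-primitive_root g.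
Variables (e s N : nat).
Local Notation f := s.+1.
Hypothesis e_gt0 : (0 < e)%N.
Hypothesis ef : (e * f)%N = n.
Local Notation C := (uroots F f).
Hypothesis C_ds : forall d : F, d != 0 -> shift_count f d = N.

Let gam := g ^+ e.
Let g0 : g != 0. Proof. exact: prim_root_neq0 g_prim. Qed.
Let gam0 : gam != 0. Proof. exact: expf_neq0. Qed.

Let gam_prim : f.-primitive_root gam.
Proof.
have := dvdn_prim_root g_prim (m := f); rewrite -ef mulnK //.
by apply; exact: dvdn_mull.
Qed.

Let CM x y : x \in C -> (x * y \in C) = (y \in C).
Proof. by rewrite !inE exprMn => /eqP->; rewrite mul1r. Qed.

Let gamC j : gam ^+ j \in C.
Proof. by rewrite inE exprAC (prim_expr_order gam_prim) expr1n. Qed.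

Let gam_inj : injective (fun j : 'I_f => gam ^+ j).
Proof.
move=> i j /eqP; rewrite (eq_prim_root_expr gam_prim) => /eqP.
by rewrite !modn_small // => E; apply: val_inj.
Qed.

Let gam_im : [set gam ^+ (j : 'I_f) | j in 'I_f] = C.
Proof.
apply/setP => x; apply/imsetP/idP => [[j _ ->]|]; first exact: gamC.
by rewrite inE => /eqP /(prim_rootP gam_prim)[j ->]; exists j.
Qed.

Let gamD (i j : 'I_f) : gam ^+ (i + j)%R = gam ^+ i * gam ^+ j.
Proof. by rewrite -exprD /= expr_mod // prim_expr_order. Qed.

Let D (i : 'I_e) : {set Zmod f} := [set j : 'I_f | gam ^+ j - g ^+ i \in C].

Let cardD i : #|D i| = N.
Proof.
rewrite -(C_ds (expf_neq0 i g0)) /shift_count -(card_imset _ gam_inj); apply: eq_card => x.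
apply/imsetP/idP => [[j]|].
  by rewrite !inE => jD ->; rewrite jD andbT; have := gamC j; rewrite inE.
rewrite inE => /andP[]; rewrite -{1}gam_im => /imsetP[j _ ->] jD.
by exists j => //; rewrite inE.
Qed.

(* The quotients of the coset representatives g^i by the elements of C: they
   run once through the nonzero elements of F. *)
Let u (ij : 'I_e * 'I_f) : F := g ^+ ij.1 / gam ^+ ij.2.

Let u_inj : injective u.
Proof.
case=> i j [i' j'] /= E; have : g ^+ i * gam ^+ j' = g ^+ i' * gam ^+ j.
  apply: (mulIf (invr_neq0 (expf_neq0 j gam0))).
  rewrite mulrAC -/(u (i, j)) E /u /= mulfK ?expf_neq0 // mulfVK ?expf_neq0 //.
move=> E'.
have ii : i = i'.
  move/eqP: E'; rewrite -!exprM -!exprD (eq_prim_root_expr g_prim) -ef => /eqP.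
  move=> /(congr1 (fun t => t %% e)%N); rewrite !modn_dvdm ?dvdn_mulr //.
  have res (a : 'I_e) b : ((a + e * b) %% e = a)%N.
    by rewrite mulnC addnC modnMDl modn_small.
  by rewrite !res => h; apply: val_inj.
by move: E'; rewrite ii => /(mulfI (expf_neq0 _ g0)) /gam_inj ->.
Qed.

Let u_im : [set u ij | ij : 'I_e * 'I_f] = [set~ 0].
Proof.
apply/eqP; rewrite eqEcard cardsC1 card_imset // card_prod !card_ord ef leqnn andbT.
apply/subsetP => x /imsetP[ij _ ->]; rewrite !inE.
by rewrite mulf_neq0 ?invr_eq0 ?expf_neq0.
Qed.

(* After division by gam^j the two memberships defining D i become conditions
   on u (i, j) alone; r is the multiplicative difference that corresponds to d. *)
Let thetaD (d : Zmod f) : d != 0 -> ((theta D d).+1 = N)%N.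
Proof.
move=> d0; pose r := gam ^+ (d : 'I_f).
have r1 : 1 - r != 0.
  by rewrite subr_eq0 -(expr0 gam) eq_sym; move: d0; rewrite -(inj_eq gam_inj).
pose P (x : F) := (1 - x \in C) && (r - x \in C).
have -> : theta D d = (\sum_(ij : 'I_e * 'I_f) if P (u ij) then 1 else 0)%N.
  rewrite -(pair_bigA _ (fun i j => if P (u (i, j)) then 1 else 0)%N) /=.
  apply: eq_bigr => i _; rewrite -big_mkcond sum1dep_card.
  rewrite -(card_imset _ (f := fun j : Zmod f => (d + j, j))); last by move=> x y [].
  have PE (j : 'I_f) : P (u (i, j)) = (j \in D i) && (d + j \in D i).
    have gj0 : gam ^+ j != 0 by exact: expf_neq0.
    rewrite /P -(CM _ (gamC j)) -(CM (r - _) (gamC j)) !mulrBr mulr1 /u /=.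
    by rewrite mulrCA divff // mulr1 [_ * r]mulrC -gamD !inE.
  apply: eq_card => -[x y]; rewrite inE /=; apply/idP/imsetP => [|[j]].
    case/and4P=> xD yD _ /eqP dE; exists y; last by rewrite -dE subrK.
    by rewrite inE PE -dE subrK yD.
  rewrite inE PE => /andP[jD djD] [-> ->]; rewrite jD djD addrK eqxx andbT /=.
  by rewrite -subr_eq0 addrK.
have -> : (\sum_ij (if P (u ij) then 1 else 0) = #|[set x | (x != 0%R) && P x]|)%N.
  rewrite -big_mkcond sum1dep_card -(card_imset _ u_inj); apply: eq_card => x.
  rewrite inE; apply/imsetP/idP => [[ij]|/andP[]].
    rewrite inE => Pij ->; rewrite Pij andbT.
    by rewrite mulf_neq0 ?invr_eq0 ?expf_neq0.
  move=> x0; have : x \in [set~ 0] by rewrite !inE.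
  rewrite -u_im => /imsetP[ij _ ->] Pij.
  by exists ij; rewrite // inE.
(* x = 1 - u maps the solutions u to the pairs counted for the shift 1 - r;
   u = 0 corresponds to x = 1. *)
rewrite -(C_ds r1) /shift_count [RHS](cardsD1 1).
have -> : (1 : F) \in [set x in C | x - (1 - r) \in C] = true.
  by rewrite !inE expr1n eqxx opprB addrC subrK; have := gamC d; rewrite inE.
rewrite add1n; congr S; rewrite -(card_imset _ (@reflect_inj F)).
apply: eq_card => x; apply/imsetP/idP => [[y]|].
  rewrite inE => /andP[y0 /andP[Py1 Py2]] ->; rewrite in_setD1 inE Py1.
  have -> : 1 - y - (1 - r) = r - y by ring.
  by rewrite Py2 !andbT -subr_eq0 addrC addKr oppr_eq0.
rewrite in_setD1 inE => /and3P[x1 xC xrC]; exists (1 - x); last by ring.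
have xx : 1 - (1 - x) = x by ring.
rewrite inE /P xx xC subr_eq0 eq_sym x1 /=.
by have -> : r - (1 - x) = x - (1 - r) by ring.
Qed.

Lemma DF_of_difference_set : DF_exists (Zmod f) N (N%:Z - 1).
Proof.
exists e, D; split=> //; split=> [i|d d0]; first exact: cardD.
by move: (theta D d) (thetaD d0) => t <-; rewrite -addn1 PoszD addrK.
Qed.

End DifferenceSet.

(** * Binomial coefficients and norm forms *)

Section Binomial.
Local Open Scope nat_scope.

Lemma logn_fact_widen p n N : prime p -> n <= N ->
  logn p n`! = \sum_(1 <= k < N.+1) n %/ p ^ k.
Proof.
move=> pp nN; rewrite logn_fact // [RHS](big_cat_nat (n := n.+1)) //=.
rewrite [X in _ = _ + X]big_nat_cond [X in _ = _ + X]big1 ?addn0 // => k /andP[/andP[nk _] _].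
apply: divn_small; apply: leq_trans nk _; exact: ltnW (ltn_expl _ (prime_gt1 pp)).
Qed.

(** In base p the digits of f = (p^m - 1) / e are all equal to (p - 1) / e, so
adding i f and j f produces no carry.  In the form used here: modulo p^k with
k <= m the number f leaves s = (p^k - 1) / e, whose multiples up to e s are smaller than
p^k, hence the floors in Legendre's formula are additive; for k > m all of them are 0. *)
Lemma prime_Ndvd_bin p m e f i j : prime p -> e %| p.-1 -> 0 < e ->
  e * f = (p ^ m).-1 -> i + j <= e -> ~~ (p %| 'C((i + j) * f, i * f)).
Proof.
move=> pp ep e0 ef ije; have p1 := prime_gt1 pp.
have le : i * f <= (i + j) * f by rewrite leq_mul2r leq_addr orbT.
have fl k : (i + j) * f %/ p ^ k = i * f %/ p ^ k + j * f %/ p ^ k.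
  have pk0 : 0 < p ^ k by rewrite expn_gt0 ltnW.
  have [s es] : exists s, e * s = (p ^ k).-1.
    have : e %| (p ^ k).-1 by apply: dvdn_trans ep _; rewrite -!subn1 -{2}(exp1n k) subn_exp dvdn_mulr.
    by case/dvdnP => s ->; exists s; rewrite mulnC.
  have [fs ->] : exists t, f = t * p ^ k + (if k <= m then s else f).
    case: leqP => km; last by exists 0.
    have : p ^ k %| (p ^ m).-1 - (p ^ k).-1.
      have -> : (p ^ m).-1 - (p ^ k).-1 = p ^ m - p ^ k.
        by have := leq_pexp2l (ltnW p1) km; lia.
      by rewrite dvdn_subr ?dvdn_exp2l // leq_pexp2l // ltnW.
    rewrite -ef -es -mulnBr Gauss_dvdr; last first.
      apply: coprimeXl; rewrite coprime_sym; apply: coprime_dvdl ep _.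
      by rewrite coprime_sym; case: (p) p1 => // p' _; exact: coprimeSn.
    case/dvdnP=> t tE; exists t; rewrite -tE subnK //.
    by rewrite -(leq_pmul2l e0) es ef; have := leq_pexp2l (ltnW p1) km; lia.
  set r := if _ then _ else _.
  have er : e * r < p ^ k.
    rewrite /r; case: (leqP k m) => km; first by rewrite es; lia.
    by rewrite ef; have := ltn_exp2l m k p1; rewrite km; lia.
  have dl a : a <= e -> a * (fs * p ^ k + r) %/ p ^ k = a * fs.
    move=> ae; rewrite mulnDr mulnA divnMDl // divn_small ?addn0 //.
    by apply: leq_ltn_trans er; rewrite leq_mul2r ae orbT.
  rewrite !dl //; first (by rewrite mulnDl); lia.
have := congr1 (logn p) (bin_fact le).
rewrite !lognM ?muln_gt0 ?fact_gt0 ?bin_gt0 //.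
have -> : (i + j) * f - i * f = j * f by rewrite mulnDl addKn.
rewrite !(@logn_fact_widen p _ ((i + j) * f)) //; last by rewrite leq_mul2r leq_addl orbT.
rewrite -big_split /= (eq_bigr _ (fun k _ => fl k)) -[RHS]add0n => /addIn E.
by apply: contra_eqN E => pC; rewrite -lt0n logn_gt0 mem_primes pp bin_gt0 le.
Qed.

End Binomial.

(** Brahmagupta's identity
(c x + mu d y)^2 + mu (c y - d x)^2 = q^2
leaves no room for a nonzero multiple c y - d x of q, unless mu = 1 and the
other square vanishes; in that case the two squares are exchanged. *)
Lemma norm_form_unique_dvd (mu q c d x y : int) :
  0 < mu -> 0 < q -> c ^+ 2 + mu * d ^+ 2 = q -> x ^+ 2 + mu * y ^+ 2 = q ->
  (q %| c * y - d * x)%Z -> c ^+ 2 = x ^+ 2 \/ mu = 1 /\ c ^+ 2 = y ^+ 2.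
Proof.
move=> mu0 q0 cd xy /dvdzP[k kE].
have E : (c * x + mu * d * y) ^+ 2 + mu * k ^+ 2 * q ^+ 2 = q ^+ 2.
  transitivity ((c ^+ 2 + mu * d ^+ 2) * (x ^+ 2 + mu * y ^+ 2)); last by rewrite cd xy expr2.
  transitivity ((c * x + mu * d * y) ^+ 2 + mu * (k * q) ^+ 2); first by ring.
  by rewrite -kE; ring.
have mk : mu * k ^+ 2 <= 1.
  have q2 : 0 < q ^+ 2 by rewrite exprn_gt0.
  rewrite -(ler_pM2r q2) mul1r -[X in _ <= X]E lerDr; exact: sqr_ge0.
have qI (s t : int) : s * q = t * q -> s = t by move/(mulIf (lt0r_neq0 q0)).
have [k0|k0] := eqVneq k 0.
  left; apply: qI; move/eqP: kE; rewrite k0 mul0r subr_eq0 => /eqP cy.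
  transitivity ((c * x) ^+ 2 + mu * (c * y) ^+ 2); first by rewrite -xy; ring.
  by rewrite cy -cd; ring.
right; have k2 : 1 <= k ^+ 2 by rewrite -gtz0_ge1 exprn_even_gt0.
have mu1 : mu = 1.
  by have := ler_peMr (ltW mu0) k2; move: mk mu0; clear; lia.
split=> //; have k21 : k ^+ 2 = 1.
  by apply/eqP; rewrite eq_le k2 andbT; rewrite mu1 mul1r in mk.
move: E; rewrite mu1 k21 !mul1r -[RHS]add0r => /addIr/eqP; rewrite sqrf_eq0 addr_eq0 => /eqP cx.
apply: qI; transitivity ((c * x) ^+ 2 + (c * y) ^+ 2); first by rewrite -xy mu1; ring.
by rewrite cx -cd mu1; ring.
Qed.

(** The product (c y - d x) (c y + d x) mu is a multiple of q = p^m.  The prime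
p cannot divide both of the first two factors, whose sum is 2 c y, so q divides
one of them. *)
Lemma norm_form_unique (p m : nat) (mu c d x y : int) :
  prime p -> odd p -> 0 < mu -> ~~ (p %| mu)%Z ->
  c ^+ 2 + mu * d ^+ 2 = (p ^ m)%N -> x ^+ 2 + mu * y ^+ 2 = (p ^ m)%N ->
  ~~ (p %| c)%Z -> ~~ (p %| y)%Z ->
  c ^+ 2 = x ^+ 2 \/ mu = 1 /\ c ^+ 2 = y ^+ 2.
Proof.
move=> pp p_odd mu0 pmu cd xy pc py.
have pM (s t : int) : (p %| s * t)%Z = (p %| s)%Z || (p %| t)%Z.
  by rewrite !dvdzE abszM Euclid_dvdM.
have q0 : 0 < (p ^ m)%N :> int by rewrite ltz_nat expn_gt0 prime_gt0.
have key (s t : int) : s * t * mu = (c ^+ 2 - x ^+ 2) * (p ^ m)%N -> ~~ (p %| t)%Z ->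
    ((p ^ m)%N %| s)%Z.
  move=> E pt; rewrite -(@Gauss_dvdzl _ _ (t * mu)) ?mulrA ?E ?dvdz_mull //.
  by move: pt pmu; rewrite !dvdzE /= => pt pmu; rewrite coprimezE /= coprimeXl // prime_coprime // abszM Euclid_dvdM // negb_or (negbTE pt) (negbTE pmu).
have prodE : (c * y - d * x) * (c * y + d * x) * mu = (c ^+ 2 - x ^+ 2) * (p ^ m)%N.
  transitivity (c ^+ 2 * (x ^+ 2 + mu * y ^+ 2) - (c ^+ 2 + mu * d ^+ 2) * x ^+ 2); first by ring.
  by rewrite cd xy; ring.
have [pcy|pcy] := boolP (p %| c * y + d * x)%Z; last first.
  exact: (@norm_form_unique_dvd mu _ c d x y mu0 q0 cd xy (key _ _ prodE pcy)).
apply: (@norm_form_unique_dvd mu _ c (- d) x y mu0 q0) => //; first by rewrite sqrrN.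
rewrite mulNr opprK; apply: key (c * y - d * x) _ _; first by rewrite -prodE; ring.
apply/negP => pcy'.
have : (p %| 2 * c * y)%Z.
  have -> : 2 * c * y = (c * y - d * x) + (c * y + d * x) by ring.
  exact: rpredD.
rewrite !pM (negbTE pc) (negbTE py) !orbF dvdzE /= dvdn_prime2 // => /eqP p2.
by move: p_odd; rewrite p2.
Qed.

Lemma square_odd_mod8 (k : nat) : odd k -> (k ^ 2 = 1 %[mod 8])%N.
Proof.
move=> ko; have -> : k = (k./2 * 2 + 1)%N by rewrite muln2 addn1 -[LHS]odd_double_half ko.
have : ~~ odd (k./2 * (k./2).+1) by rewrite oddM /= andbN.
move: (k./2) => t /even_halfK E.
have -> : ((t * 2 + 1) ^ 2 = (t * t.+1)./2 * 8 + 1)%N by lia.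
by rewrite modnMDl.
Qed.

(** The exponent [m] is odd, and odd squares are 1 modulo 8. *)
Lemma prime_mod8 (p m : nat) : odd p -> (forall k, (p ^ m)%N <> (k ^ 2)%N) ->
  (p ^ m = p %[mod 8])%N.
Proof.
move=> po nsq; have mo : odd m.
  apply/negPn/negP => me; apply: (nsq (p ^ m./2)%N).
  by rewrite -expnM muln2 even_halfK.
rewrite -[m]odd_double_half mo -mul2n expnD expnM -modnMmr -modnXm.
by rewrite square_odd_mod8 // modnXm exp1n modnMmr muln1 expn1.
Qed.

(** * Counting pairs of e-th powers with a given difference *)

Section CyclotomicNumbers.

Variables (F : finFieldType) (g : F).
Local Notation n := #|F|.-1.
Hypothesis g_prim : n.-primitive_root g.
Variables (e f : nat) (z : algC).
Hypotheses (e_gt0 : (0 < e)%N) (f_gt0 : (0 < f)%N) (ef : (e * f)%N = n).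
Hypothesis z_prim : e.-primitive_root z.
Local Notation chi := (@chi F g algC).
Local Notation J := (@Jacobi F g algC).
Local Notation C := (uroots F f).

Lemma prim_root_dvd_expn i : (z ^+ i) ^+ n = 1.
Proof. by rewrite -ef -exprM mulnCA exprM (prim_expr_order z_prim) expr1n. Qed.

Lemma sum_chi_uroots x : \sum_(i < e) chi (z ^+ i) x = e%:R * (x \in C)%:R.
Proof.
have [->|x0] := eqVneq x 0.
  rewrite big1 => [|i _]; last exact: chi0.
  by rewrite inE expr0n gtn_eqF // [0 == 1]eq_sym oner_eq0 mulr0.
rewrite (eq_bigr (fun i : 'I_e => (z ^+ dlog g x) ^+ i)); last first.
  by move=> i _; rewrite /chi (negbTE x0) exprAC.
have -> : (x \in C) = (z ^+ dlog g x == 1).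
  rewrite inE -{1}(dlogK g_prim x0) -exprM -(prim_order_dvd g_prim) -ef.
  by rewrite dvdn_pmul2r // (prim_order_dvd z_prim).
have we : (z ^+ dlog g x) ^+ e = 1 by rewrite exprAC (prim_expr_order z_prim) expr1n.
have [->|w1] := eqVneq (z ^+ dlog g x) 1.
  by rewrite (eq_bigr (fun _ => 1)) ?sumr_const ?card_ord ?mulr1 // => i _; rewrite expr1n.
rewrite mulr0; apply/eqP; have /eqP := subrX1 (z ^+ dlog g x) e.
by rewrite we subrr eq_sym mulf_eq0 subr_eq0 (negbTE w1).
Qed.

(** Expand both indicator functions by [sum_chi_uroots] and substitute x = d t
in x - (x - d) = d. *)
Lemma shift_countE d : d != 0 ->
  e%:R ^+ 2 * (shift_count f d)%:R =
    \sum_(i < e) \sum_(j < e)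
      chi z d ^+ (i + j) * chi z (-1) ^+ j * J (z ^+ i) (z ^+ j).
Proof.
move=> d0.
have chiE i x : x != 0 -> chi (z ^+ i) x = chi z x ^+ i.
  by move=> x0; rewrite /chi (negbTE x0) exprAC.
have N10 : -1 != 0 :> F by rewrite oppr_eq0 oner_eq0.
transitivity (\sum_x (\sum_(i < e) chi (z ^+ i) x) * (\sum_(j < e) chi (z ^+ j) (x - d))).
  under [RHS]eq_bigr => x _ do rewrite !sum_chi_uroots mulrACA -expr2 -natrM mulnb.
  rewrite -mulr_sumr; congr (_ * _).
  rewrite /shift_count -sum1_card natr_sum [LHS]big_mkcond /=; apply: eq_bigr => x _.
  by rewrite inE; case: ifP.
rewrite (reindex_inj (mulfI d0)) /=.
under eq_bigr => x _ do rewrite mulr_suml.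
rewrite exchange_big /=; apply: eq_bigr => i _.
under eq_bigr => x _ do rewrite mulr_sumr.
rewrite exchange_big /=; apply: eq_bigr => j _.
rewrite /Jacobi mulr_sumr; apply: eq_bigr => x _.
have -> : d * x - d = d * ((-1) * (1 - x)) by ring.
rewrite !chiM ?prim_root_dvd_expn // (chiE i d d0) (chiE j d d0) (chiE j _ N10) exprD; ring.
Qed.

Lemma chiN1 : ~~ odd e -> odd f -> chi z (-1) = -1.
Proof.
move=> e_even f_odd; have ne : ~~ odd n by rewrite -ef oddM negb_and e_even.
have zn := prim_root_dvd_expn 1; rewrite expr1 in zn.
rewrite -(even_prim_half g_prim ne) chiX //.
have -> : (n./2 = e./2 * f)%N by rewrite -ef -{1}(even_halfK e_even) -doubleMl doubleK.
rewrite exprM; suff -> : z ^+ e./2 = -1 by rewrite -signr_odd f_odd expr1.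
have : (z ^+ e./2) ^+ 2 = 1 by rewrite -exprM muln2 even_halfK // (prim_expr_order z_prim).
move/eqP; rewrite sqrf_eq1 => /orP[|/eqP//].
by rewrite -(prim_order_dvd z_prim) => /dvdn_leq; have := even_halfK e_even; lia.
Qed.

End CyclotomicNumbers.

(** * Quartic and octic Jacobi sums as quadratic integers *)

Section Integrality.

Variables (F : finFieldType) (p : nat).
Hypothesis pF : p \in [pchar F].

Lemma intr_neq0_Ndvd (c : int) : (c%:~R : F) != 0 -> ~~ (p %| c)%Z.
Proof.
by apply: contra => /dvdzP[k ->]; rewrite rmorphM /= -[p%:~R]pmulrn pcharf0 // mulr0.
Qed.

Lemma natr_Ndvd_neq0 k : ~~ (p %| k)%N -> (k%:R : F) != 0.
Proof. by rewrite (dvdn_pcharf pF). Qed.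

End Integrality.

Section JacobiIntegers.

Variables (F : finFieldType) (g : F) (p m : nat).
Local Notation n := #|F|.-1.
Hypothesis g_prim : n.-primitive_root g.
Hypotheses (pF : p \in [pchar F]) (m_gt0 : (0 < m)%N) (cardF : #|F| = (p ^ m)%N).

Let p_pr : prime p. Proof. exact: pcharf_prime pF. Qed.
Let n_gt0 : (0 < n)%N.
Proof. by have := finNzRing_gt1 F; case: #|F| => [|[]]. Qed.
Let nE : n = (p ^ m).-1. Proof. by rewrite cardF. Qed.

Section Quartic.

Variable f : nat.
Hypotheses (nf : (4 * f)%N = n) (p4 : (4 %| p.-1)%N).

(** The second sum is the conjugate of the first.  One pair [a], [b] serves all
fields of values. *)
Lemma quartic_coef (j : nat) : exists a b : int, forall (R : fieldType) (z : R),
  z ^+ 2 = -1 ->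
  Jacobi g z (z ^+ j) = a%:~R + b%:~R * z /\
  Jacobi g (z ^+ 3) ((z ^+ 3) ^+ j) = a%:~R - b%:~R * z.
Proof.
pose c k := Jacobi_coef g 4 1 j k.
exists ((c 0)%:Z - (c 2)%:Z), ((c 1)%:Z - (c 3)%:Z) => R z z2.
have z4 : z ^+ 4 = 1 by rewrite (exprM z 2 2) z2 sqrrN expr1n.
have E (y : R) : y ^+ 4 = 1 -> Jacobi g y (y ^+ j) = 
    (c 0)%:R + (c 1)%:R * y + (c 2)%:R * y ^+ 2 + (c 3)%:R * y ^+ 3.
  move=> y4; rewrite -[y in LHS]expr1 (@Jacobi_coefE F g R y 4 1 j) //.
  by rewrite unlock /=; rewrite -/(c 0) -/(c 1) -/(c 2) -/(c 3); ring.
rewrite !E //; last by rewrite exprAC z4 expr1n.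
rewrite -!exprM !rmorphB /= -!pmulrn.
have -> : z ^+ (3 * 2) = -1 by rewrite mulnC exprM z2; ring.
have -> : z ^+ (3 * 3) = z by rewrite (exprD z 8 1) (exprM z 4 2) z4 expr1n mul1r.
have -> : z ^+ 3 = - z by rewrite exprS z2; ring.
by rewrite z2; split; ring.
Qed.

(** In [F], with [y = g ^+ f] in the place of [z], the Jacobi sum is 0 and its
conjugate is a nonzero binomial coefficient, so their sum [2 a] is nonzero
modulo p. *)
Lemma quartic_Jacobi (j : nat) (z : algC) : z ^+ 2 = -1 -> (0 < j < 3)%N ->
  exists a b : int, [/\ Jacobi g z (z ^+ j) = a%:~R + b%:~R * z,
    Jacobi g (z ^+ 3) ((z ^+ 3) ^+ j) = a%:~R - b%:~R * z,
    a ^+ 2 + b ^+ 2 = #|F|%:Z & ~~ (p %| a)%Z].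
Proof.
move=> z2 j12; have [a [b ab]] := quartic_coef j.
have [E1 E2] := ab _ z z2; exists a, b; split=> //.
  apply/eqP; rewrite -(eqr_int algC) -pmulrn; apply/eqP.
  have z4 : z ^+ 4 = 1 by rewrite (exprM z 2 2) z2 sqrrN expr1n.
  have zn : z ^+ n = 1 by rewrite -nf exprM z4 expr1n.
  have N11 := algC_N1_neq1.
  have z1 : z != 1 by apply: contraNneq N11 => z1; rewrite -z2 z1 expr1n.
  have z3 : z ^+ 3 != 1.
    by apply: contraNneq z1 => z3; rewrite -z4 exprS z3 mulr1.
  have zV : z ^+ 3 = z^-1.
    have z0 : z != 0 by exact: uroot_neq0 zn.
    by apply: (mulfI z0); rewrite divff // -exprS.
  have [zj1 zj2] : z ^+ j != 1 /\ z * z ^+ j != 1.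
    by case: j j12 {ab E1 E2} => [|[|[|]]] //; rewrite ?expr1 -?expr2 -?exprS ?z2.
  have := @Jacobi_mul_inv F g g_prim z (z ^+ j) zn (urootX _ zn) z1 zj1 zj2.
  rewrite -exprVn -zV E1 E2 => <-; rewrite !rmorphD !rmorphXn /=.
  transitivity (a%:~R ^+ 2 - b%:~R ^+ 2 * z ^+ 2 : algC); last by ring.
  by rewrite z2; ring.
have f0 : (0 < f)%N by case: (f) nf n_gt0 => // <-; rewrite muln0.
pose y := g ^+ f.
have y2 : y ^+ 2 = -1.
  rewrite -exprM -(even_prim_half g_prim) -nf ?oddM //.
  by congr (_ ^+ _); clear; lia.
have [F1 F2] := ab _ y y2.
have H1 : Jacobi g y (y ^+ j) = 0.
  have [jl ju] : (f <= f * j /\ f * j <= f * 2)%N.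
    by case/andP: j12 => j0 j3; rewrite leq_pmulr // leq_mul2l -ltnS j3 orbT.
  have [B1 B2 B3 B4] : [/\ 0 < f * j, f < 4 * f, f * j < 4 * f & f + f * j < 4 * f]%N.
    by split; move: f0 jl ju; clear; lia.
  by rewrite -exprM (Jacobi_pow g_prim pF m_gt0 cardF) -?nf // leqNgt B4.
have H2 : Jacobi g (y ^+ 3) ((y ^+ 3) ^+ j) != 0.
  have Cn k : (k < 4)%N -> (0 < k)%N -> - (-1) ^+ f * ('C(k * f, f))%:R != 0 :> F.
    move=> k4 k0; rewrite mulf_neq0 ?oppr_eq0 ?signr_eq0 //.
    rewrite (natr_Ndvd_neq0 pF) //; have := @prime_Ndvd_bin p m 4 f 1 k.-1 p_pr p4 isT.
    by rewrite mul1n add1n prednK // nf => -> //; exact: ltnW.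
  case: j j12 {ab E1 E2 F1 F2 H1} => [|[|[|]]] // _.
    rewrite expr1 -exprM (Jacobi_pow g_prim pF m_gt0 cardF) -?nf; try by move: f0; clear; lia.
    rewrite ifT; last by move: f0; clear; lia.
    by have -> : (4 * f - f * 3 = f)%N by [clear; lia]; rewrite mulnC Cn.
  have -> : (y ^+ 3) ^+ 2 = y ^+ 2.
    by rewrite -exprM (exprD y 4 2) (exprM y 2 2) y2 sqrrN expr1n mul1r.
  rewrite -!exprM (Jacobi_pow g_prim pF m_gt0 cardF) -?nf; try by move: f0; clear; lia.
  rewrite ifT; last by move: f0; clear; lia.
  by have -> : (4 * f - f * 3 = f)%N by [clear; lia]; rewrite mulnC Cn.
apply: (intr_neq0_Ndvd pF); apply: contraNneq H2 => a0.
by rewrite F2 a0; move: F1; rewrite H1 a0 !add0r => <-; rewrite oppr0.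
Qed.

End Quartic.
Section Octic.

Variable f : nat.
Hypotheses (nf : (8 * f)%N = n) (p8 : (8 %| p.-1)%N) (f_odd : odd f).

(** Adding the Jacobi sums of the four characters of order 8 isolates the
rational part; the combination that changes sign under [z] to [z ^+ 5] isolates
the multiple of z + z^3, a square root of -2. *)
Lemma octic_coef : exists c d : int, forall (R : fieldType) (z : R),
  z ^+ 4 = -1 ->
  Jacobi g z (-1) + Jacobi g (z ^+ 3) (-1) + Jacobi g (z ^+ 5) (-1)
    + Jacobi g (z ^+ 7) (-1) = 4 * c%:~R /\
  Jacobi g z (-1) + Jacobi g (z ^+ 3) (-1) - Jacobi g (z ^+ 5) (-1)
    - Jacobi g (z ^+ 7) (-1) = 2 * d%:~R * (z + z ^+ 3).
Proof.
pose c k := Jacobi_coef g 8 1 4 k.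
exists ((c 0)%:Z - (c 4)%:Z), ((c 1)%:Z + (c 3)%:Z - (c 5)%:Z - (c 7)%:Z) => R z z4.
have E (y : R) : y ^+ 4 = -1 -> Jacobi g y (-1) =
    (c 0)%:R - (c 4)%:R + ((c 1)%:R - (c 5)%:R) * y
    + ((c 2)%:R - (c 6)%:R) * y ^+ 2 + ((c 3)%:R - (c 7)%:R) * y ^+ 3.
  move=> y4; rewrite -y4 -[y in LHS]expr1 expr1 -{1}[y]expr1 (@Jacobi_coefE F g R y 8 1 4) //; last first.
    by rewrite (exprM y 4 2) y4 sqrrN expr1n.
  rewrite unlock /= -/(c 0) -/(c 1) -/(c 2) -/(c 3) -/(c 4) -/(c 5) -/(c 6) -/(c 7).
  have -> : y ^+ 7 = - y ^+ 3 by rewrite (exprD y 4 3) y4 mulN1r.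
  have -> : y ^+ 6 = - y ^+ 2 by rewrite (exprD y 4 2) y4 mulN1r.
  have -> : y ^+ 5 = - y by rewrite (exprD y 4 1) y4 mulN1r.
  by rewrite y4; ring.
have odd4 k : odd k -> (z ^+ k) ^+ 4 = -1.
  by move=> ko; rewrite exprAC z4 -signr_odd ko expr1.
rewrite !E ?odd4 // -!exprM !(rmorphB, rmorphD) /= -!pmulrn.
have z8 : z ^+ 8 = 1 by rewrite (exprM z 4 2) z4 sqrrN expr1n.
have red k l : z ^+ (8 * k + l) = z ^+ l by rewrite exprD exprM z8 expr1n mul1r.
rewrite (red 0 6) (red 1 1) (red 1 2) (red 1 7) (red 1 6) (red 2 5) expr1.
have -> : z ^+ 7 = - z ^+ 3 by rewrite (exprD z 4 3) z4 mulN1r.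
have -> : z ^+ 6 = - z ^+ 2 by rewrite (exprD z 4 2) z4 mulN1r.
have -> : z ^+ 5 = - z by rewrite (exprD z 4 1) z4 mulN1r.
by split; ring.
Qed.

(** The two symmetry hypotheses say that the Jacobi sum lies in the field of
sqrt(-2).  As in the quartic case, p does not divide [c] because in [F] two of
the four sums are 0 and the others are one and the same binomial
coefficient. *)
Lemma octic_Jacobi (z : algC) : z ^+ 4 = -1 ->
  Jacobi g (z ^+ 3) (-1) = Jacobi g z (-1) ->
  Jacobi g (z ^+ 5) (-1) = Jacobi g (z ^+ 7) (-1) ->
  exists c d : int, [/\ Jacobi g z (-1) + Jacobi g (z ^+ 7) (-1) = 2 * c%:~R,
    c ^+ 2 + 2 * d ^+ 2 = #|F|%:Z & ~~ (p %| c)%Z].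
Proof.
move=> z4 J3 J5; have [c [d cd]] := octic_coef.
have [E1 E2] := cd _ z z4; rewrite J3 J5 in E1 E2.
have two0 : 2 != 0 :> algC by rewrite pnatr_eq0.
have K1 : Jacobi g z (-1) + Jacobi g (z ^+ 7) (-1) = 2 * c%:~R.
  by apply: (mulfI two0); rewrite mulrA -natrM -E1; ring.
have K2 : Jacobi g z (-1) - Jacobi g (z ^+ 7) (-1) = d%:~R * (z + z ^+ 3).
  by apply: (mulfI two0); rewrite mulrA -E2; ring.
have z8 : z ^+ 8 = 1 by rewrite (exprM z 4 2) z4 sqrrN expr1n.
have zn : z ^+ n = 1 by rewrite -nf exprM z8 expr1n.
have N11 := algC_N1_neq1.
have norm : Jacobi g z (-1) * Jacobi g (z ^+ 7) (-1) = #|F|%:R.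
  have z1 : z != 1 by apply: contraNneq N11 => z1; rewrite -z4 z1 expr1n.
  have z1' : z * -1 != 1.
    rewrite mulrN1; apply: contraNneq N11 => z1'; rewrite -z4.
    by have -> : z ^+ 4 = (- z) ^+ 4 by [ring]; rewrite z1' expr1n.
  have zV : z ^+ 7 = z^-1.
    have z0 : z != 0 by exact: uroot_neq0 zn.
    by apply: (mulfI z0); rewrite divff // -exprS.
  have N1n : (-1) ^+ n = 1 :> algC by rewrite -z4 exprAC zn expr1n.
  by have := @Jacobi_mul_inv F g g_prim z (-1) zn N1n z1 N11 z1'; rewrite invrN1 -zV.
(* (K + Kb)^2 - (K - Kb)^2 = 4 K Kb for the two conjugate sums K and Kb. *)
have q4 : (2 * c) ^+ 2 + 2 * d ^+ 2 = 4 * #|F|%:Z.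
  apply/eqP; rewrite -(eqr_int algC); apply/eqP.
  rewrite !(rmorphD, rmorphM, rmorphXn) /= -!pmulrn -norm -K1.
  have -> : 2 * d%:~R ^+ 2 = - (d%:~R * (z + z ^+ 3)) ^+ 2 :> algC.
    transitivity (- d%:~R ^+ 2 * (z ^+ 2 + 2 * z ^+ 4 + z ^+ 4 * z ^+ 2) : algC); last by ring.
    by rewrite z4; ring.
  by rewrite -K2; ring.
have [d' dE] : exists d', d = 2 * d'.
  have : ~~ odd `|d|.
    apply/negP => d_odd; have [k kE] : exists k, d = 2 * k + 1.
      by exists (d %/ 2)%Z; move: d_odd; clear; lia.
    by rewrite kE in q4; move: q4; clear; lia.
  by move=> dev; exists (d %/ 2)%Z; move: dev; clear; lia.
exists c, d'; split=> //; first by rewrite dE in q4; move: q4; clear; lia.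
have f0 : (0 < f)%N by case: (f) nf n_gt0 => // <-; rewrite muln0.
pose y := g ^+ f.
have y4 : y ^+ 4 = -1.
  rewrite -exprM -(even_prim_half g_prim) -nf ?oddM //.
  by congr (_ ^+ _); clear; lia.
have [F1 _] := cd _ y y4.
rewrite -y4 -!exprM in F1.
have JP k : (0 < k < 8)%N -> Jacobi g (g ^+ (f * k)) (g ^+ (f * 4)) =
   if (4 <= k)%N then (-1) ^+ k.+1 * 'C(4 * f, (8 - k) * f)%:R else 0 :> F.
  move=> /andP[k0 k8].
  have [B1 B2 B3 B4] : [/\ 0 < f * k, 0 < f * 4, f * k < 8 * f & f * 4 < 8 * f]%N.
    by rewrite [(8 * f)%N]mulnC !ltn_pmul2l // !muln_gt0 f0.
  rewrite (Jacobi_pow g_prim pF m_gt0 cardF) -?nf //.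
  have -> : (8 * f <= f * k + f * 4)%N = (4 <= k)%N.
    by rewrite -[RHS](leq_pmul2l f0) -[RHS](leq_add2r (f * 4)); congr (_ <= _)%N; clear; lia.
  case: ifP => // k4; rewrite [(f * 4)%N]mulnC.
  have -> : (8 * f - f * k = (8 - k) * f)%N by rewrite mulnBl [(f * k)%N]mulnC.
  by congr (_ * _); rewrite -signr_odd oddM f_odd andbT oddB; [rewrite signr_odd exprS; ring|exact: ltnW].
have F1' : ('C(4 * f, f)%:R *+ 2 : F) = 4 * c%:~R.
  have C3 : 'C(4 * f, (8 - 5) * f) = 'C(4 * f, f).
    by rewrite -bin_sub; [congr binomial|]; clear; lia.
  have C1 : 'C(4 * f, (8 - 7) * f) = 'C(4 * f, f) by congr binomial; clear; lia.
  have J1 := JP 1%N isT; rewrite muln1 in J1.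
  by rewrite -F1 J1 !JP // C3 C1 /=; ring.
apply: (intr_neq0_Ndvd pF); apply/eqP => c0.
have : 'C(4 * f, f)%:R != 0 :> F.
  rewrite (natr_Ndvd_neq0 pF) //; have := @prime_Ndvd_bin p m 8 f 1 3 p_pr p8 isT.
  by rewrite mul1n nf => -> //.
have n_even : ~~ odd n by rewrite -nf oddM.
apply/negP; rewrite negbK; move/eqP: F1'; rewrite c0 mulr0 -mulr_natl mulf_eq0.
by rewrite (negbTE (two_neq0 g_prim n_even)).
Qed.

End Octic.
End JacobiIntegers.

(** * Explicit pair counts for e = 2, 4, 8 *)

(** The sum of [shift_countE] for chi(-1) = -1, with the Jacobi sums abstracted
as [T] and the value of the character at d as [w]. *)
Definition signed_sum (T : nat -> nat -> algC) (w : algC) (e : nat) : algC :=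
  \sum_(i < e) \sum_(j < e) w ^+ (i + j) * (-1) ^+ j * T i j.

Lemma quartic_sum (T : nat -> nat -> algC) (w Q : algC) :
  w ^+ 4 = 1 -> (forall i j, T i j = T j i) ->
  (T 0 0)%N = Q - 2 -> (forall j, (0 < j < 4)%N -> (T 0 j)%N = -1) ->
  (T 1 3)%N = 1 -> (T 2 2)%N = -1 ->
  signed_sum T w 4 = Q - 5 - w ^+ 2 * (2 + (T 1 1)%N + (T 3 3)%N).
Proof.
move=> w4 TC T00 T0 T13 T22.
rewrite /signed_sum !big_ord_recr !big_ord0 /= T00 !(TC _ 0%N) !T0 //.
rewrite (TC 3 1) (TC 3 2) (TC 2 1) T13 T22.
by ring: w4.
Qed.

(** [K], [Kb] and [L], [Lb] are the two pairs of conjugate Jacobi sums to which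
all others reduce; [u] is the value at 4 of a character of order 8. *)
Lemma octic_sum (T : nat -> nat -> algC) (w Q u K Kb L Lb : algC) :
  w ^+ 8 = 1 -> (forall i j, T i j = T j i) ->
  (T 0 0)%N = Q - 2 -> (forall j, (0 < j < 8)%N -> (T 0 j)%N = -1) ->
  (T 1 7)%N = 1 -> (T 2 6)%N = -1 -> (T 3 5)%N = 1 -> (T 4 4)%N = -1 ->
  (T 1 1)%N = u * K -> (T 3 3)%N = u * K -> (T 5 5)%N = u * Kb -> (T 7 7)%N = u * Kb ->
  (T 1 3)%N = - K -> (T 5 7)%N = - Kb -> 
  (T 1 5)%N = u * L -> (T 2 2)%N = L -> (T 2 4)%N = L ->
  (T 3 7)%N = u * Lb -> (T 6 6)%N = Lb -> (T 4 6)%N = Lb ->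
  signed_sum T w 8 = Q - 9 + w ^+ 4 * (L + Lb + 2 * (K + Kb) - 2)
    + w ^+ 2 * (2 * (1 - u) * Lb - u * (K + Kb) - 2)
    + w ^+ 6 * (2 * (1 - u) * L - u * (K + Kb) - 2).
Proof.
move=> w8 TC T00 T0 T17 T26 T35 T44 T11 T33 T55 T77 T13 T57 T15 T22 T24 T37 T66 T46.
rewrite /signed_sum !big_ord_recr !big_ord0 /= T00 !(TC _ 0%N) !T0 //.
rewrite (TC 2 1) (TC 3 1) (TC 4 1) (TC 5 1) (TC 6 1) (TC 7 1) (TC 3 2) (TC 4 2).
rewrite (TC 5 2) (TC 6 2) (TC 7 2) (TC 4 3) (TC 5 3) (TC 6 3) (TC 7 3) (TC 5 4).
rewrite (TC 6 4) (TC 7 4) (TC 6 5) (TC 7 5) (TC 7 6).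
rewrite T17 T26 T35 T44 T11 T33 T55 T77 T13 T57 T15 T22 T24 T37 T66 T46.
by ring: w8.
Qed.

Section CyclotomicFormulas.

Variables (F : finFieldType) (g : F).
Local Notation n := #|F|.-1.
Hypothesis g_prim : n.-primitive_root g.
Variables (e f : nat) (z : algC).
Hypotheses (e_gt0 : (0 < e)%N) (e_even : ~~ odd e) (f_odd : odd f) (ef : (e * f)%N = n).
Hypothesis z_prim : e.-primitive_root z.
Local Notation chi := (@chi F g algC).
Local Notation J := (@Jacobi F g algC).
Local Notation T := (fun i j : nat => J (z ^+ i) (z ^+ j)).

Let f_gt0 : (0 < f)%N. Proof. by case: f f_odd. Qed.
Let cN1 : chi z (-1) = -1. Proof. exact: (chiN1 g_prim e_gt0 f_gt0 ef z_prim e_even f_odd). Qed.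
Let zn i : (z ^+ i) ^+ n = 1. Proof. exact: (prim_root_dvd_expn ef z_prim). Qed.

Lemma prim_root_expn_neq1 i : (0 < i < e)%N -> z ^+ i != 1.
Proof.
move=> /andP[i0 ie]; rewrite -(prim_order_dvd z_prim); apply/negP => /dvdn_leq.
by move=> /(_ i0); rewrite leqNgt ie.
Qed.

Lemma shift_count_sum d : d != 0 ->
  e%:R ^+ 2 * (shift_count f d)%:R = signed_sum T (chi z d) e.
Proof. by move=> d0; rewrite (shift_countE g_prim f_gt0 ef z_prim d0) cN1. Qed.

Lemma chi_expn_order d : d != 0 -> chi z d ^+ e = 1.
Proof. by move=> d0; rewrite /chi (negbTE d0) exprAC (prim_expr_order z_prim) expr1n. Qed.

Lemma chi_expN1 i : chi (z ^+ i) (-1) = (-1) ^+ i.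
Proof. by rewrite -cN1 /chi oppr_eq0 oner_eq0 exprAC. Qed.

Lemma Jacobi_exp00 : (T 0 0)%N = #|F|%:R - 2. Proof. by rewrite /= expr0 Jacobi11. Qed.

Lemma Jacobi_exp0 j : (0 < j < e)%N -> (T 0 j)%N = -1.
Proof. by move=> je; rewrite /= expr0 Jacobi1 // prim_root_expn_neq1. Qed.

Lemma Jacobi_exp_opp i : (0 < i < e)%N -> T i (e - i)%N = - (-1) ^+ i.
Proof.
move=> ie /=; have -> : z ^+ (e - i) = (z ^+ i)^-1.
  have zi0 : z ^+ i != 0 by exact: uroot_neq0 (zn i).
  apply: (mulfI zi0); rewrite divff // -exprD subnKC ?(prim_expr_order z_prim) //.
  by case/andP: ie => _ /ltnW.
by rewrite Jacobi_inv // ?prim_root_expn_neq1 // chi_expN1.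
Qed.

End CyclotomicFormulas.

Section Formulas.

Variables (F : finFieldType) (g : F).
Local Notation n := #|F|.-1.
Hypothesis g_prim : n.-primitive_root g.
Variable f : nat.
Hypothesis f_odd : odd f.
Local Notation chi := (@chi F g algC).
Local Notation J := (@Jacobi F g algC).

Let f_gt0 : (0 < f)%N. Proof. by case: f f_odd. Qed.

Lemma shift_count2 (d : F) : (2 * f)%N = n -> d != 0 ->
  4 * (shift_count f d)%:R = #|F|%:R - 3 :> algC.
Proof.
move=> nf d0; have zP : 2.-primitive_root (-1 : algC).
  have [z zP] := C_prim_root_exists (isT : (0 < 2)%N).
  suff <- : z = -1 by [].
  have := prim_expr_order zP; move/eqP; rewrite sqrf_eq1 => /orP[|/eqP//].
  by rewrite -[z]expr1 -(prim_order_dvd zP).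
have := shift_count_sum g_prim (e := 2) isT isT f_odd nf zP d0.
rewrite -natrX /signed_sum !big_ord_recr !big_ord0 /=.
have w2 := chi_expn_order g zP d0.
have Jacobi_exp00 := Jacobi_exp00 g (-1 : algC); rewrite /= in Jacobi_exp00.
have T01 := Jacobi_exp0 g_prim nf zP (j := 1) isT; rewrite /= in T01.
have T11 := Jacobi_exp_opp g_prim (e := 2) isT isT f_odd nf zP (i := 1) isT; rewrite /= in T11.
rewrite Jacobi_exp00 T01 T11 JacobiC T01 => ->.
by ring: w2.
Qed.

Section Quartic.

Hypothesis nf : (4 * f)%N = n.
Variable z : algC.
Hypothesis zP : 4.-primitive_root z.

Lemma shift_count4 (d : F) : d != 0 ->
  16 * (shift_count f d)%:R =
    #|F|%:R - 5 - chi z d ^+ 2 * (2 + J z z + J (z ^+ 3) (z ^+ 3)).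
Proof.
move=> d0; have := shift_count_sum g_prim (e := 4) isT isT f_odd nf zP d0.
rewrite -natrX (@quartic_sum _ _ #|F|%:R) ?expr1 //.
- exact: chi_expn_order.
- by move=> i j; exact: JacobiC.
- exact: Jacobi_exp00.
- by move=> j; exact: (Jacobi_exp0 g_prim nf zP).
- by rewrite (Jacobi_exp_opp g_prim (e := 4) isT isT f_odd nf zP (i := 1)) // expr1 opprK.
- by rewrite (Jacobi_exp_opp g_prim (e := 4) isT isT f_odd nf zP (i := 2)) // sqrrN expr1n.
Qed.

End Quartic.

Section Octic.

Hypothesis nf : (8 * f)%N = n.
Variable z : algC.
Hypothesis zP : 8.-primitive_root z.

Lemma prim8_expr4 : z ^+ 4 = -1.
Proof.
have : (z ^+ 4) ^+ 2 = 1 by rewrite -exprM (prim_expr_order zP).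
move/eqP; rewrite sqrf_eq1 => /orP[|/eqP//].
by rewrite -(prim_order_dvd zP).
Qed.

Let n_even : ~~ odd n. Proof. by rewrite -nf oddM. Qed.
Let zn i : (z ^+ i) ^+ n = 1. Proof. exact: (prim_root_dvd_expn nf zP). Qed.

Let u := chi z 4.

(** For an element y of order 8, y + y^-1 is a square root of 2.  Hence 4 is a
fourth power, and the square of its character value is an eighth power. *)
Lemma chi4_sqr : u ^+ 2 = 1.
Proof.
pose y := g ^+ f; have y4 : y ^+ 4 = -1.
  rewrite -exprM -(even_prim_half g_prim n_even) -nf; congr (_ ^+ _); clear; lia.
have y0 : y != 0 by rewrite expf_neq0 // (prim_root_neq0 g_prim).
have s2 : (y + y^-1) ^+ 2 = 2.
  transitivity ((y ^+ 4 + 2 * y ^+ 2 + 1) / y ^+ 2); first by field.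
  by rewrite y4; field.
have s0 : y + y^-1 != 0.
  by apply: contraNneq (two_neq0 g_prim n_even) => s0; rewrite -s2 s0 expr0n.
rewrite /u; have -> : 4 = (y + y^-1) ^+ 4 :> F by rewrite (exprM _ 2 2) s2; ring.
have z1 := zn 1; rewrite expr1 in z1.
by rewrite chi_exp_arg // -exprM chi_expn_order.
Qed.

Local Notation T := (fun i j : nat => J (z ^+ i) (z ^+ j)).

Let z_neq1 i : (0 < i < 8)%N -> z ^+ i != 1. Proof. exact: prim_root_expn_neq1. Qed.

(* [Jacobi_reflect] in terms of exponents modulo 8. *)
Let Treflect i j k : (8 %| i + j + k)%N -> T i j = (-1) ^+ i * T i k.
Proof.
rewrite (prim_order_dvd zP) !exprD => /eqP zijk /=.
rewrite Jacobi_reflect // (chi_expN1 g_prim (e := 8) isT isT f_odd nf zP).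
congr (_ * J _ _); have z0 : z ^+ i * z ^+ j != 0.
  by rewrite mulf_neq0 // (uroot_neq0 (zn _)).
by apply: (mulfI z0); rewrite divff.
Qed.

Let chiz4 i : chi (z ^+ i) 4 = u ^+ i.
Proof.
have f4 : 4 != 0 :> F.
  by have -> : 4 = 2 * 2 :> F by [ring]; rewrite mulf_neq0 // (two_neq0 g_prim n_even).
by rewrite /u /chi (negbTE f4) exprAC.
Qed.

Let u_odd i : odd i -> u ^+ i = u.
Proof.
by move=> io; rewrite -(odd_double_half i) io exprD -mul2n exprM chi4_sqr expr1n mulr1.
Qed.

Let Tdouble i : (0 < i < 8)%N -> u ^+ i * T i i = T i 4%N.
Proof.
move=> i8; rewrite -chiz4 /= prim8_expr4; apply: (Jacobi_double g_prim n_even) => //.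
exact: z_neq1.
Qed.

Let Toppo i : odd i -> u * T i (i + 4)%N = T (2 * i)%N 4%N.
Proof.
move=> io /=; rewrite -{1}(u_odd io) -chiz4 exprD prim8_expr4 mulrN1 mulnC exprM.
apply: (Jacobi_mulN1 g_prim n_even) => //.
rewrite exprAC prim8_expr4 -signr_odd io expr1.
exact: algC_N1_neq1.
Qed.

Let TC i j : T i j = T j i. Proof. exact: JacobiC. Qed.

Local Notation K := (J z (-1)).
Local Notation Kb := (J (z ^+ 7) (-1)).

(** By reflection both sides are -J(chi, chi^3), which is symmetric in the two
characters. *)
Lemma octic_J3 : J (z ^+ 3) (-1) = K.
Proof.
have /= E13 := @Treflect 1 4 3 isT; have /= E34 := @Treflect 3 4 1 isT.
by rewrite -prim8_expr4 E34 -[z in RHS]expr1 E13 expr1 JacobiC; ring.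
Qed.

(** As for [octic_J3], with the characters chi^5 and chi^7. *)
Lemma octic_J5 : J (z ^+ 5) (-1) = Kb.
Proof.
have /= E54 := @Treflect 5 4 7 isT; have /= E74 := @Treflect 7 4 5 isT.
by rewrite -prim8_expr4 E54 E74 JacobiC; ring.
Qed.

Local Notation L := (J (z ^+ 2) (-1)).
Local Notation Lb := (J (z ^+ 6) (-1)).

(** Jacobi sums J(chi^i, chi^j) with i + j even reduce to those against the
quadratic character: those with i = j by doubling, those with j = i + 4 by
duplication, and (1,3) and (5,7) by reflection. *)
Lemma shift_count8 (d : F) : d != 0 ->
  64 * (shift_count f d)%:R =
    #|F|%:R - 9 + chi z d ^+ 4 * (L + Lb + 2 * (K + Kb) - 2)
    + chi z d ^+ 2 * (2 * (1 - u) * Lb - u * (K + Kb) - 2)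
    + chi z d ^+ 6 * (2 * (1 - u) * L - u * (K + Kb) - 2) :> algC.
Proof.
move=> d0; have := shift_count_sum g_prim (e := 8) isT isT f_odd nf zP d0.
have uI (s t : algC) : u * s = t -> s = u * t.
  by move=> <-; rewrite mulrA -expr2 chi4_sqr mul1r.
have J1 : T 1%N 4%N = K by rewrite /= expr1 prim8_expr4.
have J3 : T 3%N 4%N = K by rewrite /= prim8_expr4 octic_J3.
have J5 : T 5%N 4%N = Kb by rewrite /= prim8_expr4 octic_J5.
have J7 : T 7%N 4%N = Kb by rewrite /= prim8_expr4.
have J2 : T 2%N 4%N = L by rewrite /= prim8_expr4.
have J6 : T 6%N 4%N = Lb by rewrite /= prim8_expr4.
have sq i j : odd i -> (0 < i < 8)%N -> T i 4%N = j -> T i i = u * j.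
  by move=> io i8 <-; apply: uI; rewrite -(Tdouble i8) u_odd.
have sqe i j : ~~ odd i -> (0 < i < 8)%N -> T i 4%N = j -> T i i = j.
  move=> ie i8 <-; rewrite -(Tdouble i8) -[in u ^+ i](even_halfK ie) -mul2n exprM.
  by rewrite chi4_sqr expr1n mul1r.
rewrite -natrX (@octic_sum _ _ #|F|%:R u K Kb L Lb) //.
- exact: chi_expn_order.
- exact: Jacobi_exp00.
- by move=> j; exact: (Jacobi_exp0 g_prim nf zP).
- by rewrite (Jacobi_exp_opp g_prim (e := 8) isT isT f_odd nf zP (i := 1)) // expr1 opprK.
- by rewrite (Jacobi_exp_opp g_prim (e := 8) isT isT f_odd nf zP (i := 2)) // sqrrN expr1n.
- rewrite (Jacobi_exp_opp g_prim (e := 8) isT isT f_odd nf zP (i := 3)) //; ring.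
- rewrite (Jacobi_exp_opp g_prim (e := 8) isT isT f_odd nf zP (i := 4)) //; ring.
- exact: sq.
- exact: sq.
- exact: sq.
- exact: sq.
- by rewrite (@Treflect 1 3 4 isT) J1 expr1 mulN1r.
- by rewrite (@Treflect 5 7 4 isT) J5; ring.
- by apply: uI; rewrite (@Toppo 1 isT).
- exact: sqe.
- by apply: uI; rewrite (@Toppo 3 isT).
- exact: sqe.
- by rewrite TC.
Qed.

End Octic.
End Formulas.

(** * The three families *)

Lemma DF_of_shift_count (F : finFieldType) (g : F) (e f N : nat) :
  #|F|.-1.-primitive_root g -> (0 < e)%N -> (0 < f)%N -> (e * f)%N = #|F|.-1 ->
  (forall d : F, d != 0 -> shift_count f d = N) -> DF_exists (Zmod f) N (N%:Z - 1).
Proof. by move=> gP e0; case: f => // s _ ef cN; apply: (DF_of_difference_set gP e0 ef cN). Qed.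

Lemma prime_power_field q : prime_power q ->
  exists p m (F : finFieldType) (g : F),
    [/\ [/\ p \in [pchar F], (0 < m)%N & q = (p ^ m)%N],
        #|F| = q & #|F|.-1.-primitive_root g].
Proof.
case=> p [m [pp m0 qE]]; have [F pF cF] := pPrimePowerField pp m0.
by have [g gP] := finField_prim_root F; exists p, m, F, g; split; rewrite // cF.
Qed.

Lemma odd_sqr_mod8 (t : int) : odd `|t|%N -> exists r : nat, t ^+ 2 = 8 * r%:Z + 1.
Proof.
move=> to; have := square_odd_mod8 to; move=> E.
have -> : t ^+ 2 = (`|t| ^ 2)%N%:Z by rewrite -abszX gez0_abs ?sqr_ge0.
by exists (`|t| ^ 2 %/ 8)%N; move: (_ ^ 2)%N E => k; lia.
Qed.

(** k lies on one side of 8 x, and (8 x + 1)^2 > (8 x)^2 + 9. *)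
Lemma square_gap (x k : nat) : (0 < x)%N -> (k ^ 2 <> 64 * x ^ 2 + 9)%N.
Proof.
move=> x0; case: (leqP k (8 * x)); rewrite -leq_sqr; clear -x0; lia.
Qed.

(** For e = 2 the count is independent of d: the squares are the Paley
difference set. *)
Lemma paley_DF q : prime_power q -> (q = 3 %[mod 4])%N ->
  DF_exists (Zmod ((q - 1) %/ 2)%N) ((q - 3) %/ 4)%N ((q%:Z - 7) %/ 4)%Z.
Proof.
move=> /prime_power_field [p [m [F [g [[pF m0 qE] cF gP]]]]] q3.
have nf : (2 * ((q - 1) %/ 2) = #|F|.-1)%N by rewrite cF; move: q3; clear; lia.
have -> : ((q%:Z - 7) %/ 4)%Z = ((q - 3) %/ 4)%N%:Z - 1 by move: q3; clear; lia.
have f_odd : odd ((q - 1) %/ 2) by move: q3; clear; lia.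
apply: (DF_of_shift_count gP _ _ nf) => //; first exact: odd_gt0.
move=> d d0.
have := shift_count2 gP f_odd nf d0; rewrite cF; set N := shift_count _ _ => E.
have : 4 * N%:Z = q%:Z - 3.
  by apply/eqP; rewrite -(eqr_int algC) rmorphM rmorphB /= -!pmulrn E.
by move: q3; clear; move: N => N; lia.
Qed.

(** Here q is 5 modulo 32, so that f is odd and p is 5 modulo 8.  Integrality of
the count at d = 1, 16 N(1) = q - 7 - 2 a, forces a to be -1 modulo 8, which
leaves a = -1 among the candidates 1, -1, 2 t, -2 t. *)
Lemma quartic_DF (q : nat) (t : int) : prime_power q ->
  odd `|t|%N -> q%:Z = 1 + 4 * t ^+ 2 ->
  DF_exists (Zmod ((q - 1) %/ 4)%N) ((q - 5) %/ 16)%N ((q%:Z - 21) %/ 16)%Z.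
Proof.
move=> /prime_power_field [p [m [F [g [[pF m0 qE] cF gP]]]]] to qt.
have pp := pcharf_prime pF.
have [r tE] := odd_sqr_mod8 to; have qr : q = (32 * r + 5)%N by rewrite tE in qt; move: qt; clear; lia.
have nf : (4 * ((q - 1) %/ 4) = #|F|.-1)%N by rewrite cF; move: qr; clear; lia.
have f_odd : odd ((q - 1) %/ 4) by move: qr; clear; lia.
have p_odd : odd p.
  by have : odd (p ^ m) by [rewrite -qE; move: qr; clear; lia]; rewrite oddX gtn_eqF.
have p5 : (p = 5 %[mod 8])%N.
  rewrite -(@prime_mod8 p m p_odd) -?qE; first by move: qr; clear; lia.
  move=> k kE; have ko : odd k by have : odd (k ^ 2) by [rewrite -kE; move: qr; clear; lia]; rewrite oddX.
  by have := square_odd_mod8 ko; rewrite -kE; move: qr; clear; lia.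
have p4 : (4 %| p.-1)%N by move: p5; clear; lia.
have -> : ((q%:Z - 21) %/ 16)%Z = ((q - 5) %/ 16)%N%:Z - 1 by move: qr; clear; lia.
have [z zP] := C_prim_root_exists (isT : (0 < 4)%N).
have z2 : z ^+ 2 = -1.
  have : (z ^+ 2) ^+ 2 = 1 by rewrite -exprM (prim_expr_order zP).
  by move/eqP; rewrite sqrf_eq1 => /orP[|/eqP//]; rewrite -(prim_order_dvd zP).
have cF' := cF; rewrite qE in cF'.
have [a [b]] := quartic_Jacobi gP pF m0 cF' nf p4 z2 (isT : (0 < 1 < 3)%N).
rewrite expr1 => -[Ja Jb ab pa].
have formula (d : F) : d != 0 -> 16 * (shift_count ((q - 1) %/ 4) d)%:R =
    q%:R - 5 - chi g z d ^+ 2 * (2 + 2 * a%:~R) :> algC.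
  move=> d0; rewrite (shift_count4 gP f_odd nf zP d0) cF Ja -[z ^+ 3 in X in _ + X]expr1 Jb; ring.
have aN1 : a = -1.
  have := formula 1 (oner_neq0 F); rewrite chi1 //; last first.
    by rewrite -nf exprM (prim_expr_order zP) expr1n.
  rewrite expr1n; set N := shift_count _ _ => E.
  have {}E : 16 * N%:Z = q%:Z - 5 - (2 + 2 * a).
    apply/eqP; rewrite -(eqr_int algC) !(rmorphM, rmorphB, rmorphD) /= -!pmulrn.
    by rewrite E; apply/eqP; ring.
  have : a ^+ 2 = 1 ^+ 2 \/ 1 = 1 :> int /\ a ^+ 2 = (2 * t) ^+ 2.
    apply: (@norm_form_unique p m 1 a b 1 (2 * t)) => //.
    - by rewrite dvdzE /= dvdn1; apply: contraTneq pp => ->.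
    - by rewrite mul1r ab cF qE.
    - by rewrite -qE qt; ring.
    apply/negP => pt.
    have : (p %| (q%:Z - (2 * t) * (2 * t))%R)%Z.
      apply: rpredB; last exact: dvdz_mulr.
      by rewrite qE dvdzE /= dvdn_exp.
    have -> : q%:Z - (2 * t) * (2 * t) = 1 by rewrite qt; ring.
    by rewrite dvdzE /= dvdn1 => /eqP p1; move: pp; rewrite p1.
  by case=> [|[_]] /eqP; rewrite eqf_sqr => /orP[] /eqP a2;
    move: E a2 qr; clear; move: N => N; lia.
apply: (DF_of_shift_count gP _ _ nf) => //; first exact: odd_gt0.
move=> d d0; have := formula d d0; rewrite aN1; set N := shift_count _ _ => E.
have : 16 * N%:Z = q%:Z - 5.
  apply/eqP; rewrite -(eqr_int algC) rmorphM rmorphB /= -!pmulrn E.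
  by apply/eqP; ring.
by move: qr; clear; move: N => N; lia.
Qed.

(** Here q is 73 modulo 512, so that f is odd, and q is not a square, so that p
is 1 modulo 8.  The candidates are 3, -3, 8 x, -8 x for a, and 1, -1 for c and
for u.  Integrality of the count at d = 1 excludes u = -1 and then forces a = 3;
integrality at d = g forces c = -1. *)
Lemma octic_DF (q : nat) (x y : int) : prime_power q ->
  odd `|x|%N -> odd `|y|%N -> q%:Z = 9 + 64 * x ^+ 2 -> q%:Z = 1 + 8 * y ^+ 2 ->
  DF_exists (Zmod ((q - 1) %/ 8)%N) ((q - 9) %/ 64)%N ((q%:Z - 73) %/ 64)%Z.
Proof.
move=> /prime_power_field [p [m [F [g [[pF m0 qE] cF gP]]]]] xo yo qx qy.
have pp := pcharf_prime pF.
have [r xE] := odd_sqr_mod8 xo; have qr : q = (512 * r + 73)%N by rewrite xE in qx; move: qx; clear; lia.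
set f := ((q - 1) %/ 8)%N.
have nf : (8 * f = #|F|.-1)%N by rewrite cF /f; move: qr; clear; lia.
have nf4 : (4 * (2 * f) = #|F|.-1)%N by rewrite -nf; clear; lia.
have f_odd : odd f by rewrite /f; move: qr; clear; lia.
have p_odd : odd p.
  by have : odd (p ^ m) by [rewrite -qE; move: qr; clear; lia]; rewrite oddX gtn_eqF.
have p1 : (p = 1 %[mod 8])%N.
  rewrite -(@prime_mod8 p m p_odd) -?qE; first by move: qr; clear; lia.
  move=> k kE.
  apply: (@square_gap `|x| k); first by case: `|x|%N xo.
  by apply/eqP; rewrite -eqz_nat -kE qx PoszD PoszM -abszX gez0_abs ?sqr_ge0 //; apply/eqP; ring.
have p8 : (8 %| p.-1)%N by move: p1; clear; lia.
have p4 : (4 %| p.-1)%N by move: p1; clear; lia.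
have -> : ((q%:Z - 73) %/ 64)%Z = ((q - 9) %/ 64)%N%:Z - 1 by move: qr; clear; lia.
have [z zP] := C_prim_root_exists (isT : (0 < 8)%N).
have z4 := prim8_expr4 zP; have z22 : (z ^+ 2) ^+ 2 = -1 by rewrite -exprM.
have cF' := cF; rewrite qE in cF'.
have [a [b [Ja Jb ab pa]]] := quartic_Jacobi gP pF m0 cF' nf4 p4 z22 (isT : (0 < 2 < 3)%N).
have z6 : (z ^+ 2) ^+ 3 = z ^+ 6 by rewrite -exprM.
have z62 : (z ^+ 6) ^+ 2 = -1 by rewrite -exprM (exprM z 4 3) z4 -signr_odd expr1.
rewrite z22 in Ja; rewrite z6 z62 in Jb.
have [c [d [Jc cd pc]]] := octic_Jacobi gP pF m0 cF' nf p8 f_odd z4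
  (octic_J3 gP f_odd nf zP) (octic_J5 gP f_odd nf zP).
have pN k : (p %| q%:Z - k)%Z -> (p %| k)%Z.
  move=> pk; have -> : k = q%:Z - (q%:Z - k) by ring.
  by apply: rpredB => //; rewrite qE dvdzE /= dvdn_exp.
have c1 : c ^+ 2 = 1.
  have : c ^+ 2 = 1 ^+ 2 \/ 2 = 1 :> int /\ c ^+ 2 = (2 * y) ^+ 2.
    apply: (@norm_form_unique p m 2 c d 1 (2 * y)) => //.
    - by rewrite dvdzE /= dvdn_prime2 //; apply: contraTneq p_odd => ->.
    - by rewrite cd cF qE.
    - by rewrite -qE qy; ring.
    apply/negP => py; have /pN : (p %| (q%:Z - 1)%R)%Z.
      by have -> : q%:Z - 1 = (2 * y) * (4 * y) by [rewrite qy; ring]; exact: dvdz_mulr.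
    by rewrite dvdzE /= dvdn1 => /eqP E; rewrite E in pp.
  by case=> [->|[]] //; rewrite expr1n.
have a9 : a ^+ 2 = 3 ^+ 2 \/ a ^+ 2 = (8 * x) ^+ 2.
  have : a ^+ 2 = 3 ^+ 2 \/ 1 = 1 :> int /\ a ^+ 2 = (8 * x) ^+ 2.
    apply: (@norm_form_unique p m 1 a b 3 (8 * x)) => //.
    - by rewrite dvdzE /= dvdn1; apply: contraTneq pp => ->.
    - by rewrite mul1r ab cF qE.
    - by rewrite -qE qx; ring.
    apply/negP => px; have /pN : (p %| (q%:Z - 3 * 3)%R)%Z.
      by have -> : q%:Z - 3 * 3 = (8 * x) * (8 * x) by [rewrite qx; ring]; exact: dvdz_mulr.
    rewrite dvdzE abszM Euclid_dvdM // orbb /= dvdn_prime2 //.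
    by move=> /eqP p3; move: p1; rewrite p3.
  by case=> [|[]]; [left|right].
pose u := chi g z 4.
have u2 : u ^+ 2 = 1 := chi4_sqr gP nf zP.
have formula (h : F) (w : algC) : h != 0 -> w = chi g z h -> 64 * (shift_count f h)%:R =
    q%:R - 9 + w ^+ 4 * (2 * a%:~R + 4 * c%:~R - 2)
    + w ^+ 2 * (2 * (1 - u) * (a%:~R - b%:~R * z ^+ 2) - 2 * u * c%:~R - 2)
    + w ^+ 6 * (2 * (1 - u) * (a%:~R + b%:~R * z ^+ 2) - 2 * u * c%:~R - 2) :> algC.
  move=> h0 ->; rewrite (shift_count8 gP f_odd nf zP h0) cF Ja Jb Jc -/u; ring.
have zn : z ^+ #|F|.-1 = 1 by rewrite -nf exprM (prim_expr_order zP) expr1n.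
have F1 := formula 1 1 (oner_neq0 F) (esym (chi1 gP zn)).
have u1 : u = 1.
  move/eqP: u2; rewrite sqrf_eq1 => /orP[/eqP//|/eqP uN1].
  have : 64 * (shift_count f (1 : F))%:Z = q%:Z - 15 + 10 * a + 8 * c.
    apply/eqP; rewrite -(eqr_int algC) !(rmorphM, rmorphB, rmorphD) /= -!pmulrn.
    by rewrite F1 uN1; apply/eqP; ring.
  move: (shift_count _ _) => N E.
  have /orP[/eqP c'|/eqP c'] : (c == 1) || (c == -1) by rewrite -sqrf_eq1 c1.
    by case: a9 => /eqP; rewrite eqf_sqr => /orP[] /eqP a';
      move: E a' c' qr; clear; lia.
  by case: a9 => /eqP; rewrite eqf_sqr => /orP[] /eqP a';
      move: E a' c' qr; clear; lia.
have a3 : a = 3.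
  have : 64 * (shift_count f (1 : F))%:Z = q%:Z - 15 + 2 * a.
    apply/eqP; rewrite -(eqr_int algC) !(rmorphM, rmorphB, rmorphD) /= -!pmulrn.
    by rewrite F1 u1; apply/eqP; ring.
  move: (shift_count _ _) => N E.
  by case: a9 => /eqP; rewrite eqf_sqr => /orP[] /eqP a';
    move: E a' qr; clear; lia.
have chig : z = chi g z g by rewrite -[g in chi _ _ g]expr1 chiX // expr1.
have cN1 : c = -1.
  have Fg := formula g z (prim_root_neq0 gP) chig.
  have : 64 * (shift_count f g)%:Z = q%:Z - 13 - 4 * c.
    apply/eqP; rewrite -(eqr_int algC) !(rmorphM, rmorphB, rmorphD) /= -!pmulrn.
    by rewrite Fg u1 a3; apply/eqP; ring: z4.
  move: (shift_count _ _) => N E.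
  by have /orP[/eqP c'|/eqP c'] : (c == 1) || (c == -1) by [rewrite -sqrf_eq1 c1];
    move: E c' qr; clear; lia.
apply: (DF_of_shift_count gP _ _ nf) => //; first exact: odd_gt0.
move=> h h0; have := formula h _ h0 erefl; rewrite u1 a3 cN1; set N := shift_count _ _ => E.
have : 64 * N%:Z = q%:Z - 9.
  apply/eqP; rewrite -(eqr_int algC) rmorphM rmorphB /= -!pmulrn E.
  by apply/eqP; ring.
by move: qr; clear; move: N => N; lia.
Qed.

Theorem proposition2p2 :
  [/\ (forall q : nat, prime_power q -> (q = 3 %[mod 4])%N ->
         DF_exists (Zmod ((q - 1) %/ 2)%N) ((q - 3) %/ 4)%N
           ((q%:Z - 7) %/ 4)%Z),
      (forall (q : nat) (t : int), prime_power q ->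
         odd `|t|%N -> q%:Z = 1 + 4 * t ^+ 2 ->
         DF_exists (Zmod ((q - 1) %/ 4)%N) ((q - 5) %/ 16)%N
           ((q%:Z - 21) %/ 16)%Z)
    & (forall (q : nat) (a b : int), prime_power q ->
         odd `|a|%N -> odd `|b|%N ->
         q%:Z = 9 + 64 * a ^+ 2 -> q%:Z = 1 + 8 * b ^+ 2 ->
         DF_exists (Zmod ((q - 1) %/ 8)%N) ((q - 9) %/ 64)%N
           ((q%:Z - 73) %/ 64)%Z)].
Proof.
split=> [q|q t|q a b]; [exact: paley_DF|exact: quartic_DF|exact: octic_DF].
Qed.
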